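(* Let $V$ and $U$ be finite digraphs, potentially with cycles, whose nodes are coloured white or gray and whose gray nodes have outdegree at most $1$. Let $G=(V,x)$ and $H=(U,y)$ be two games with $x$ and $y$ white nodes. Then the Grundy value $\mathcal G(G+H)$ of the disjunctive sum is obtained from $\mathcal G(G)$ (row) and $\mathcal G(H)$ (column) by the following table: $$\begin{array}{c|ccccc} + & \mathrm{Full} & \infty_{\mathbf D'} & \mathrm{Moon}_{\mathbf F'} & \mathrm{Nym}_{f'} & n'\\ \hline \mathrm{Full} & \mathrm{Full} & \mathrm{Full} & \mathrm{Full} & \mathrm{Full} & \mathrm{Full}\\ \infty_{\mathbf D} & \mathrm{Full} & \infty_{\emptyset} & \infty_{\mathbf D\oplus\mathbf F'} & \infty_{f'\oplus\mathbf D} & \infty_{n'\oplus\mathbf D}\\ \mathrm{Moon}_{\mathbf F} & \mathrm{Full} & \infty_{\mathbf F\oplus\mathbf D'} & \mathrm{Moon}_{\mathbf F\oplus\mathbf F'} & \mathrm{Moon}_{f'\oplus\mathbf F} & \mathrm{Moon}_{n'\oplus\mathbf F}\\ \mathrm{Nym}_{f} & \mathrm{Full} & \infty_{f\oplus\mathbf D'} & \mathrm{Moon}_{f\oplus\mathbf F'} & \mathrm{Nym}_{f\oplus f'} & \mathrm{Nym}_{f\oplus n'}\\ n & \mathrm{Full} & \infty_{n\oplus\mathbf D'} & \mathrm{Moon}_{n\oplus\mathbf F'} & \mathrm{Nym}_{n\oplus f'} & n\oplus n' \end{array}$$ Here $n,n',f,f'\in\mathbb Z_0^+$, and $\mathbf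 D,\mathbf F,\mathbf D',\mathbf F'$ are subsets of $\mathbb Z_0^+$ (the subscripts of the Grundy values of $G$ and $H$).
   Context: $\mathbb Z_0^{+}$ denotes the nonnegative integers. $\oplus$ on $\mathbb Z_0^+$ is nim-sum (bitwise XOR of binary expansions); for $m\in\mathbb Z_0^+$ and sets $S,S'\subseteq\mathbb Z_0^+$, $m\oplus S=\{m\oplus s:s\in S\}$ and $S\oplus S'=\{s\oplus s':s\in S,s'\in S'\}$ (empty if $S$ or $S'$ is empty). A game is a pair $G=(V,x)$, where $x$ is a node of the digraph $V$ (the location of a piece). The options of $G$ are the games $G'=(V,x')$ with an arc from $x$ to $x'$; $G'$ denotes a generic option of $G$ and $G''$ a generic option of $G'$. An option is white or gray according to the colour of its node. A node is terminal if it has no outgoing arcs. $\mathrm{mex}(S)$ is the least nonnegative integer not in $S$. Disjunctive sum. The cartproduct $V\ast U$ is the digraph whose nodes are the pairs $(x,y)\in V\times U$ with $x,y$ not both gray, and in which there is an arc from $(x,y)$ to $(x^*,y^* )$ if and only if either $\langle x,x^*\rangle$ is an arc of $V$ and $y=y^*$ is white, or $\langle y,y^*\rangle$ is an arc of $U$ and $x=x^*$ is white. A node $(x,y)$ of $V\ast U$ is gray if one of $x,y$ is gray, and white if both are white. For $G=(V,x)$ and $H=(U,y)$ with $x,y$ not both gray, $G+H=(V\ast U,(x,y))$. Labels. At step $n$ of the algorithm below, applied to a finite digraph $V$ whose gray nodes have outdegree at most $1$, a game $G=(V,x)$ with $x$ white has a label $\mathcal G_n(G)\in\mathbb Z_0^+\cup\{\mathrm{Full},\mathrm{Moon},\infty\}$,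 and a game $G=(V,x)$ with $x$ gray has a label $\mathcal C_n(G)$ which is $\mathrm{New}$, $\mathrm{Full}$, $\infty$, or a subset of $\mathbb Z_0^+$ that is finite or has finite complement. Here $\mathrm{Full}$ (full moon), $\mathrm{New}$ (new moon) and $\mathrm{Moon}$ are formal symbols, and the label $\infty$ means ''unassigned''. Function Cr (evaluated with the step-$n$ labels). For $k\in\mathbb Z_0^+$ and $G=(V,x)$ with $x$ gray: if $x$ is terminal, $\mathrm{Cr}(G,k)=\textsc{true}$. Otherwise $\mathrm{Cr}(G,k)=\textsc{true}$ if every option $G'$ of $G$ falls into one of the cases: (i) $G'$ is white and $\mathcal G_n(G')\in\{\mathrm{Moon},\mathrm{Full}\}\cup(\mathbb Z_0^+\setminus\{k\})$; (ii) $G'$ has a white option $G''$ with $\mathcal G_n(G'')=k$; (iii) $G'$ has a gray option $G''$ with $\mathrm{Cr}(G'',k)=\textsc{true}$. In all other cases, including when the recursive evaluation does not reach $\textsc{true}$ because of an infinite run, $\mathrm{Cr}(G,k)=\textsc{false}$. Algorithm. Step 0. For white $x$: $\mathcal G_0(G)=0$ if $x$ is terminal and $\infty$ otherwise. For gray $x$: $\mathcal C_0(G)=\mathrm{New}$ if $x$ is terminal and $\infty$ otherwise. Step $n+1$. For every node $x$ with $G=(V,x)$ (a label to which no rule below applies is kept unchanged): White $x$: if $G$ has a gray option $G'$ with $\mathcal C_n(G')=\mathrm{New}$, then $\mathcal G_{n+1}(G)=\mathrm{Full}$. Otherwise let $D$ be the set of labels $\mathcal G_n(G')$ of white options $G'$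 with $\mathcal G_n(G')\in\mathbb Z_0^+$, and let $P$ be the union of the sets $\mathcal C_n(G')$ over gray options $G'$ that are assigned and not labelled $\mathrm{Full}$. If $\mathbb Z_0^+\subseteq D\cup P$, then $\mathcal G_{n+1}(G)=\mathrm{Moon}$. Otherwise let $m=\mathrm{mex}(D\cup P)$; if for every unassigned option $G'$ of $G$ there is a white option $G''$ of $G'$ with $\mathcal G_n(G'')=m$ or a gray option $G''$ of $G'$ with $\mathrm{Cr}(G'',m)=\textsc{true}$, then $\mathcal G_{n+1}(G)=m$. Gray $x$ whose unique option $G'$ is white: if $\mathcal G_n(G')=\mathrm{Full}$, then $\mathcal C_{n+1}(G)=\mathrm{New}$; if $\mathcal G_n(G')=k\in\mathbb Z_0^+$, then $\mathcal C_{n+1}(G)=\mathbb Z_0^+\setminus\{k\}$; if $\mathcal G_n(G')=\mathrm{Moon}$, then $\mathcal C_{n+1}(G)=\mathbb Z_0^+$. Gray $x$ whose unique option $G'$ is gray: if $\mathcal C_n(G')=\mathrm{Full}$, then $\mathcal C_{n+1}(G)=\mathrm{New}$; if $\mathcal C_n(G')=\mathrm{New}$, then $\mathcal C_{n+1}(G)=\mathrm{Full}$; if $\mathcal C_n(G')=F$ (finite set), then $\mathcal C_{n+1}(G)=\mathbb Z_0^+\setminus F$; if $\mathcal C_n(G')=\mathbb Z_0^+\setminus F$ ($F$ finite), then $\mathcal C_{n+1}(G)=F$. Ending condition: if $\mathcal G_{n+1}(G)=\mathcal G_n(G)$ and $\mathcal C_{n+1}(G)=\mathcal C_n(G)$ for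 all $G=(V,x)$, the algorithm ends, at step $t=n+1$. Direct and forcing values. For any $G=(V,x)$, the sets $\mathbf D(G),\mathbf F(G)\subseteq\mathbb Z_0^+$ are defined inductively (as the smallest sets satisfying the following rules, where $\mathcal G(\cdot)=k$ means that the final label is the integer $k$). Direct values: if $G$ has a white option $G'$ with $\mathcal G(G')=k$, then $k\in\mathbf D(G)$; if $G$ has a gray option $G'$ such that $k\in\mathbf D(G'')$ for every option $G''$ of $G'$, then $k\in\mathbf D(G)$. Forcing values: if $G$ has a gray option $G'$ with a white option $G''$ such that $\mathcal G(G'')=k$, then $k\in\mathbf F(G)$; if $G$ has a gray option $G'$ with an option $G''$ (of either colour) such that $k\in\mathbf F(G'')$, then $k\in\mathbf F(G)$. Grundy value. For white $x$ and final step $t$: $\mathcal G(G)=\mathcal G_t(G)$ if $\mathcal G_t(G)\in\mathbb Z_0^+\cup\{\mathrm{Full}\}$; $\mathcal G(G)=\mathrm{Moon}_{\mathbf F(G)}$ if $\mathcal G_t(G)=\mathrm{Moon}$; $\mathcal G(G)=\mathrm{Nym}_f$ (''nymphet $f$'') if $\mathcal G_t(G)=\infty$ and $\mathbf F(G)=\{f\}$; $\mathcal G(G)=\infty_{\mathbf D(G)}$ if $\mathcal G_t(G)=\infty$ and $\mathbf F(G)=\emptyset$. The paper asserts that when $\mathcal G_t(G)=\infty$ the set $\mathbf F(G)$ has at most one element, so that these cases are exhaustive. The Grundy value of $G+H$ is the one obtained by applying the algorithm to $V\ast U$. *)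

(* Defs.v *)
From mathcomp Require Import all_boot boolp classical_sets.
From Stdlib Require PeanoNat.

Set Implicit Arguments.
Unset Strict Implicit.
Unset Printing Implicit Defensive.

Local Open Scope classical_set_scope.

Notation nimsum := PeanoNat.Nat.lxor (only parsing).

Definition nim_shift (m : nat) (A : set nat) : set nat :=
  [set nimsum m s | s in A].

Definition nim_setsum (A A' : set nat) : set nat :=
  [set nimsum s s' | s in A & s' in A'].

Record digraph := Digraph {
  node :> finType;
  arc : rel node;
  gray : pred node
}.

Definition white (V : digraph) (x : V) : bool := ~~ gray x.

Definition gray_outdegree_le1 (V : digraph) : Prop :=
  forall x : V, gray x -> #|arc x| <= 1.

Section Cartproduct.
Variables V U : digraph.

Definition cart_node := {p : V * U | ~~ (gray p.1 && gray p.2)}.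

Definition cart_arc : rel cart_node := fun p q =>
  [|| [&& arc (val p).1 (val q).1, (val p).2 == (val q).2 & white (val p).2]
    | [&& arc (val p).2 (val q).2, (val p).1 == (val q).1 & white (val p).1]].

Definition cart_gray : pred cart_node := fun p =>
  gray (val p).1 || gray (val p).2.

Definition cartproduct : digraph :=
  {| node := cart_node; arc := cart_arc; gray := cart_gray |}.

Lemma white_not_both_gray (x : V) (y : U) :
  white x -> white y -> ~~ (gray (x, y).1 && gray (x, y).2).
Proof. by rewrite /white /= => /negbTE ->. Qed.

Definition sum_node (x : V) (y : U) (hx : white x) (hy : white y) :
  cartproduct := exist _ (x, y) (white_not_both_gray hx hy).

End Cartproduct.

(* White nodes only ever carry Num, Full, Moon or Unassigned; gray nodes only
   ever carry NatSet, Full, New or Unassigned, where the sets occurring in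
   NatSet are finite or cofinite because they are obtained from singletons and
   from setT by complementation.  Unassigned is the label written infinity. *)
Inductive label : Type :=
  | Num of nat
  | NatSet of set nat
  | Full
  | Moon
  | New
  | Unassigned.

Definition is_mex (A : set nat) (m : nat) : Prop :=
  ~ A m /\ forall k, k < m -> A k.

(* Equal to 0 when A is setT, a case in which it is not used. *)
Definition mex (A : set nat) : nat := xget 0 (is_mex A).

Section Algorithm.
Variable V : digraph.

(* A least fixed point: an evaluation of Cr that has an infinite run and never
   reaches "true" is false. *)
Inductive Cr (L : V -> label) (k : nat) : V -> Prop :=
  | Cr_node (x : V) of
      gray x & (forall y, arc x y -> Cr_option L k y) : Cr L k x
with Cr_option (L : V -> label) (k : nat) : V -> Prop :=
  | Cr_white (y : V) of
      white y & [\/ L y = Moon, L y = Full | exists2 j, L y = Num j & j <> k] :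
      Cr_option L k y
  | Cr_white_reply (y z : V) of
      arc y z & white z & L z = Num k : Cr_option L k y
  | Cr_gray_reply (y z : V) of
      arc y z & gray z & Cr L k z : Cr_option L k y.

Definition init (x : V) : label :=
  if [exists y, arc x y] then Unassigned else if gray x then New else Num 0.

Definition white_option_labels (L : V -> label) (x : V) : set nat :=
  [set k | exists y, [/\ arc x y, white y & L y = Num k]].

Definition gray_option_union (L : V -> label) (x : V) : set nat :=
  [set k | exists y A, [/\ arc x y, gray y, L y = NatSet A & A k]].

Definition reverts (L : V -> label) (m : nat) (y : V) : Prop :=
  exists2 z, arc y z & (white z /\ L z = Num m) \/ (gray z /\ Cr L m z).

Definition white_step (L : V -> label) (x : V) : label :=
  let A := white_option_labels L x `|` gray_option_union L x in
  if `[< exists y, [/\ arc x y, gray y & L y = New] >] then Full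
  else if `[< A = setT >] then Moon
  else if `[< forall y, arc x y -> L y = Unassigned -> reverts L (mex A) y >]
  then Num (mex A)
  else L x.

Definition gray_step (L : V -> label) (x : V) : label :=
  if [pick y | arc x y] is Some y then
    if white y then
      match L y with
      | Full => New
      | Num k => NatSet (~` [set k])
      | Moon => NatSet setT
      | _ => L x
      end
    else
      match L y with
      | Full => New
      | New => Full
      | NatSet A => NatSet (~` A)
      | _ => L x
      end
  else L x.

Definition step (L : V -> label) (x : V) : label :=
  if gray x then gray_step L x else white_step L x.

Definition labels (n : nat) : V -> label := iter n step init.

Definition stable (n : nat) : Prop :=
  forall x, labels n.+1 x = labels n x.

Definition ends_at (t : nat) : Prop :=
  exists n, [/\ t = n.+1, stable n & forall k, k < n -> ~ stable k].

Inductive direct (L : V -> label) (k : nat) : V -> Prop :=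
  | direct_white (x y : V) of
      arc x y & white y & L y = Num k : direct L k x
  | direct_gray (x y : V) of
      arc x y & gray y & (forall z, arc y z -> direct L k z) : direct L k x.

Inductive forcing (L : V -> label) (k : nat) : V -> Prop :=
  | forcing_now (x y z : V) of
      arc x y & gray y & arc y z & white z & L z = Num k : forcing L k x
  | forcing_later (x y z : V) of
      arc x y & gray y & arc y z & forcing L k z : forcing L k x.

Definition direct_values (L : V -> label) (x : V) : set nat :=
  [set k | direct L k x].

Definition forcing_values (L : V -> label) (x : V) : set nat :=
  [set k | forcing L k x].

End Algorithm.

Inductive gvalue : Type :=
  | GNum of nat
  | GFull
  | GMoon of set nat
  | GNym of nat
  | GInf of set nat.

Inductive value_of_labels (V : digraph) (L : V -> label) (x : V) :
    gvalue -> Prop :=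
  | value_num n of L x = Num n : value_of_labels L x (GNum n)
  | value_full of L x = Full : value_of_labels L x GFull
  | value_moon of L x = Moon :
      value_of_labels L x (GMoon (forcing_values L x))
  | value_nym f of L x = Unassigned & forcing_values L x = [set f] :
      value_of_labels L x (GNym f)
  | value_inf of L x = Unassigned & forcing_values L x = set0 :
      value_of_labels L x (GInf (direct_values L x)).

(* The Grundy value of (V, x), for x white.  It is a relation because an
   unassigned node with at least two forcing values gets no Grundy value. *)
Definition grundy (V : digraph) (x : V) (g : gvalue) : Prop :=
  white x /\ exists2 t, ends_at V t & value_of_labels (labels t) x g.

Definition gsum (g h : gvalue) : gvalue :=
  match g, h with
  | GFull, _ | _, GFull => GFull
  | GInf _, GInf _ => GInf set0
  | GInf D, GMoon F' => GInf (nim_setsum D F')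
  | GInf D, GNym f' => GInf (nim_shift f' D)
  | GInf D, GNum n' => GInf (nim_shift n' D)
  | GMoon F, GInf D' => GInf (nim_setsum F D')
  | GMoon F, GMoon F' => GMoon (nim_setsum F F')
  | GMoon F, GNym f' => GMoon (nim_shift f' F)
  | GMoon F, GNum n' => GMoon (nim_shift n' F)
  | GNym f, GInf D' => GInf (nim_shift f D')
  | GNym f, GMoon F' => GMoon (nim_shift f F')
  | GNym f, GNym f' => GNym (nimsum f f')
  | GNym f, GNum n' => GNym (nimsum f n')
  | GNum n, GInf D' => GInf (nim_shift n D')
  | GNum n, GMoon F' => GMoon (nim_shift n F')
  | GNum n, GNym f' => GNym (nimsum n f')
  | GNum n, GNum n' => GNum (nimsum n n')
  end.

Lemma ends_at_unique (V : digraph) (s t : nat) :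
  ends_at V s -> ends_at V t -> s = t.
Proof.
move=> [m [-> sm Hm]] [n [-> sn Hn]]; congr _.+1.
by case: (ltngtP m n) => // [/Hn|/Hm].
Qed.

Lemma grundy_unique (V : digraph) (x : V) (g h : gvalue) :
  grundy x g -> grundy x h -> g = h.
Proof.
move=> [_ [s es gs]] [_ [t et ht]]; rewrite (ends_at_unique es et) in gs.
case: gs ht => [n E|E|E|f E F|E F].
- by case=> [m|||f|]; rewrite E // => -[->].
- by case=> [m|||f|]; rewrite E.
- by case=> [m|||f|]; rewrite E.
- case=> [m|||f' _|]; rewrite ?E // F.
    by move/seteqP=> [/(_ f erefl) ->].
  by move=> _ /seteqP[/(_ f erefl)].
- case=> [m|||f' _|]; rewrite ?E // F.
  by move/seteqP=> [_ /(_ f' erefl)].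
Qed.

(* Main.v *)
(* Contract the runs of gray nodes, whose moves are forced.  On the white nodes
   there remains an impartial game with three kinds of moves: quiet moves, which
   pass the turn; threats, after which the same player is to move again; and
   escapes, which win on the spot or end in an endless gray run.  A disjunctive
   sum contracts to the sum of the contracted games, in which both players move
   in either component.

   The final labels have a description by least fixed points in the contracted
   game: x is labelled by the number k iff the previous player wins x + *k, it is
   Full iff a sequence of threats wins on the spot, and a label Moon also
   propagates backwards along threats.  The table is then a computation with these
   fixed points.  The one delicate point is that the sum of two positions which
   are not numbers, and from which no threats lead to a number, is not a number.
   If it were one, neither position would have any threats at all; at the least
   value m out of reach of the quiet moves of the first position there is a quiet
   move after which m is not a win, and the opponent's winning answer to it would
   be a quiet move in the second position whose own refutation shows that m was
   within reach. *)

From mathcomp Require Import all_boot boolp classical_sets zify.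
From Stdlib Require Import PeanoNat.
Require Import Defs.

Set Implicit Arguments.
Unset Strict Implicit.
Unset Printing Implicit Defensive.

(** * Nim-sums *)

Lemma nimsumK (a b : nat) : nimsum (nimsum a b) b = a.
Proof. by rewrite Nat.lxor_assoc Nat.lxor_nilpotent Nat.lxor_0_r. Qed.

Lemma nimsumKl (a b : nat) : nimsum b (nimsum b a) = a.
Proof. by rewrite -Nat.lxor_assoc Nat.lxor_nilpotent Nat.lxor_0_l. Qed.

Lemma nimsum_inj (a b c : nat) : nimsum a c = nimsum b c -> a = b.
Proof. by move=> e; rewrite -(nimsumK a c) e nimsumK. Qed.

Lemma div2_nimsum (a b : nat) :
  Nat.div2 (nimsum a b) = nimsum (Nat.div2 a) (Nat.div2 b).
Proof. by rewrite !Nat.div2_spec Nat.shiftr_lxor. Qed.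

Lemma odd_nimsum (a b : nat) : Nat.odd (nimsum a b) = xorb (Nat.odd a) (Nat.odd b).
Proof. by rewrite -!Nat.bit0_odd Nat.lxor_spec. Qed.

Lemma ltn_halves (a b : nat) : (a < b) <->
  Nat.div2 a < Nat.div2 b \/
  Nat.div2 a = Nat.div2 b /\ ~~ Nat.odd a /\ Nat.odd b.
Proof.
have := Nat.div2_odd a; have := Nat.div2_odd b.
by case: (Nat.odd a); case: (Nat.odd b) => /=; lia.
Qed.

(* The moves of a two-heap game of Nim reach every smaller nim-sum. *)
Lemma ltn_nimsum (a b j : nat) :
  j < nimsum a b -> nimsum j b < a \/ nimsum j a < b.
Proof.
have [n] := ubnP (a + b + j); elim: n a b j => // n IHn a b j lt_n.
move/ltn_halves=> [lt_j|[eq_j [/negbTE oj oab]]].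
  (* Were [a] and [b] both 0, half of [j] would lie below 0. Positivity makes the measure
     [a + b + j] drop strictly on passing to the halves. *)
  have ab_gt0: 0 < a + b.
    by case: a b lt_j {lt_n} => [|a] [|b] //; rewrite Nat.lxor_0_l.
  have [||lt_a|lt_b] := IHn (Nat.div2 a) (Nat.div2 b) (Nat.div2 j).
  - have := Nat.div2_odd a; have := Nat.div2_odd b; have := Nat.div2_odd j.
    by case: (Nat.odd _); case: (Nat.odd _); case: (Nat.odd _) => /=; lia.
  - by rewrite -div2_nimsum.
  - by left; apply/ltn_halves; left; rewrite div2_nimsum.
  - by right; apply/ltn_halves; left; rewrite div2_nimsum.
(* The halves agree, [j] is even, and exactly one of [a], [b] is odd: that one loses its last
   bit. *)
rewrite odd_nimsum in oab; case oa: (Nat.odd a) oab; case ob: (Nat.odd b) => //= _.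
- left; apply/ltn_halves; right; split=> //.
    by rewrite div2_nimsum eq_j div2_nimsum nimsumK.
  by rewrite odd_nimsum oj ob.
- right; apply/ltn_halves; right; split=> //.
    by rewrite div2_nimsum eq_j div2_nimsum Nat.lxor_comm nimsumKl.
  by rewrite odd_nimsum oj oa.
Qed.

(** * Contracted games *)

(* The white positions of a digraph once its runs of gray nodes are contracted.
   [move false x u] passes the turn: the opponent is to play at [u].
   [move true x u] is a threat: the opponent's replies are forced until the same
   player is to play at [u].  [wins x] is a threat the opponent cannot answer,
   [stalls x] a move into an endless run of gray nodes. *)
Record game := Game {
  pos :> finType;
  move : bool -> pos -> pos -> Prop;
  wins : pos -> Prop;
  stalls : pos -> Prop
}.

(* [out true k x]: from x + *k the player to move wins; [out false k x]: the
   other player wins.  A draw satisfies neither. *)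
Inductive out (G : game) : bool -> nat -> G -> Prop :=
  | out_wins k x of wins x : out true k x
  | out_move k b x u of move b x u & out b k u : out true k x
  | out_heap k j x of j < k & out false j x : out true k x
  | out_prev k x of ~ wins x & ~ stalls x &
      (forall b u, move b x u -> out (~~ b) k u) &
      (forall j, j < k -> out true j x) : out false k x.

Definition numeric (G : game) (x : G) : Prop := exists k, out false k x.

Inductive full (G : game) : G -> Prop :=
  | full_wins x of wins x : full x
  | full_move x u of move true x u & full u : full x.

(* The label Moon, up to the possibility that the position is in fact Full. *)
Inductive moonish (G : game) : G -> Prop :=
  | moonish_base x of (forall k,
      (exists2 u, move false x u & out false k u) \/
      exists u j, [/\ move true x u, out false j u & j <> k]) : moonish x
  | moonish_move x u of move true x u & moonish u : moonish x.

(** The empty sequence of threats is allowed, so a number [k] has exactly the forced value [k] and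
    enters sums through a singleton, as a nymphet does. On non-numeric white nodes these become the
    forcing values. *)
Inductive forced (G : game) (k : nat) : G -> Prop :=
  | forced_numeric x of out false k x : forced k x
  | forced_move x u of move true x u & forced k u : forced k x.

(** These become the direct values. A threat won on the spot yields every [k], because the rule for
    gray options holds vacuously at a gray terminal node. *)
Inductive reached (G : game) (k : nat) : G -> Prop :=
  | reached_wins x of wins x : reached k x
  | reached_numeric x u of move false x u & out false k u : reached k x
  | reached_move x u of move true x u & reached k u : reached k x.

Lemma outPE (G : game) (k : nat) (x : G) : out false k x ->
  [/\ ~ wins x, ~ stalls x, forall b u, move b x u -> out (~~ b) k u &
      forall j, j < k -> out true j x].
Proof.
move e: false => b o; case: o e => {b} // k' x' *; by split.
Qed.

Lemma outNE (G : game) (k : nat) (x : G) : out true k x ->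
  [\/ wins x, exists b u, move b x u /\ out b k u |
      exists2 j, j < k & out false j x].
Proof.
move e: true => b o; case: o e => {b} // k' x' *.
- by apply: Or31.
- by apply: Or32; do 2 eexists; split; eassumption.
- by apply: Or33; eexists; eassumption.
Qed.

Lemma out_excl (G : game) (b : bool) (k : nat) (x : G) :
  out b k x -> ~ out (~~ b) k x.
Proof.
elim=> {b k x} [k x w|k b x u m _ IH|k j x lt_jk _ IH|k x nw ns _ IHm _ IHh] /=.
- by case/outPE.
- by move=> /outPE[_ _ /(_ b u m)].
- by move=> /outPE[_ _ _ /(_ j lt_jk)].
- case/outNE=> [//|[b [u [m o]]]|[j lt_jk o]].
    by apply: (IHm b u m); rewrite negbK.
  exact: (IHh j lt_jk).
Qed.

Lemma out_other (G : game) (j k : nat) (x : G) :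
  out false k x -> j <> k -> out true j x.
Proof.
move=> o ne; case: (ltngtP j k) => // lt; first by case/outPE: o => _ _ _; apply.
exact: out_heap lt o.
Qed.

Lemma out_uniq (G : game) (j k : nat) (x : G) :
  out false j x -> out false k x -> j = k.
Proof.
move=> oj ok; apply: contrapT => ne; exact: out_excl (out_other ok ne) oj.
Qed.

Lemma full_out (G : game) (k : nat) (x : G) : full x -> out true k x.
Proof.
by elim=> {x} [x w|x u m _ IH]; [exact: out_wins | exact: out_move m IH].
Qed.

Lemma moonish_out (G : game) (k : nat) (x : G) : moonish x -> out true k x.
Proof.
elim=> {x} [x /(_ k)[[u m o]|[u [j [m o ne]]]]|x u m _ IH]; last exact: out_move m IH.
  exact: out_move m o.
by apply: out_move m _; apply: out_other o _ => e; apply: ne.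
Qed.

Lemma full_nnumeric (G : game) (x : G) : full x -> ~ numeric x.
Proof. by move=> f [k]; apply: out_excl (full_out k f). Qed.

Lemma moonish_nnumeric (G : game) (x : G) : moonish x -> ~ numeric x.
Proof. by move=> f [k]; apply: out_excl (moonish_out k f). Qed.

Lemma forced_out (G : game) (j k : nat) (x : G) :
  forced k x -> j <> k -> out true j x.
Proof.
by move=> f ne; elim: f => {x} [x o|x u m _ IH]; [exact: out_other o ne | exact: out_move m IH].
Qed.

Lemma reached_out (G : game) (k : nat) (x : G) : reached k x -> out true k x.
Proof.
elim=> {x} [x w|x u m o|x u m _ IH]; [exact: out_wins | exact: out_move m o | exact: out_move m IH].
Qed.

(** Finiteness enters here: no move leads to a position of number [M], so the numbers reached by
    moves have a mex. *)
Lemma numeric_bound (G : game) : exists M, forall (x : G) k, out false k x -> k < M.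
Proof.
pose f (x : G) := xget 0 [set k | out false k x]%classic.
exists (\max_x f x).+1 => x k o; rewrite ltnS.
have fo : out false (f x) x
    by exact: (@xgetPex _ 0 [set j | out false j x]%classic (ex_intro _ k o)).
by rewrite (out_uniq o fo) leq_bigmax.
Qed.

Lemma moonish_forced (G : game) (x : G) : moonish x -> exists k, forced k x.
Proof.
elim=> {x} [x base|x u m _ [k f]]; last by exists k; apply: forced_move m f.
have [M lt_M] := numeric_bound G.
(* At [k := M] the quiet alternative is impossible, which leaves a threat to a number. *)
case: (base M) => [[u _ /lt_M]|[u [j [m o _]]]]; first by rewrite ltnn.
by exists j; apply: forced_move m (forced_numeric o).
Qed.

Lemma exists_mex (A : set nat) (M : nat) : ~ A M -> exists m, is_mex A m.
Proof.
move=> nAM; have ex : exists n, ~~ `[< A n >] by exists M; apply/asboolPn.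
case: (ex_minnP ex) => m /asboolPn nAm min_m; exists m; split=> // k lt_km.
by apply: contrapT => /asboolPn /min_m; rewrite leqNgt lt_km.
Qed.

(** * Sums of contracted games *)

(* [G] is the disjunctive sum of [G1] and [G2], a position [z] standing for the
   pair of its components [l z] and [r z]; positions outside [ok] are junk. *)
Record is_sum (G1 G2 G : game) (l : G -> G1) (r : G -> G2) (ok : G -> Prop) :
    Prop := IsSum {
  sum_move b z z' : ok z -> move b z z' -> ok z' /\
    (move b (l z) (l z') /\ r z' = r z \/ move b (r z) (r z') /\ l z' = l z);
  sum_left b z u : ok z -> move b (l z) u ->
    exists z', [/\ move b z z', l z' = u & r z' = r z];
  sum_right b z u : ok z -> move b (r z) u ->
    exists z', [/\ move b z z', l z' = l z & r z' = u];
  sum_wins z : ok z -> wins z <-> wins (l z) \/ wins (r z);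
  sum_stalls z : ok z -> stalls z <-> stalls (l z) \/ stalls (r z)
}.

Lemma is_sumC (G1 G2 G : game) (l : G -> G1) (r : G -> G2) (ok : G -> Prop) :
  is_sum l r ok -> is_sum r l ok.
Proof.
case=> mv ml mr w s; split=> [b z z' oz m|b z u oz m|b z u oz m|z oz|z oz].
- by case: (mv _ _ _ oz m) => oz' [] m'; split=> //; [right | left].
- by case: (mr _ _ _ oz m) => z' [*]; exists z'; split.
- by case: (ml _ _ _ oz m) => z' [*]; exists z'; split.
- by rewrite w // or_comm.
- by rewrite s // or_comm.
Qed.

Definition drawish (G : game) (x : G) : Prop := forall k, ~ forced k x.

Lemma drawish_nnumeric (G : game) (x : G) : drawish x -> ~ numeric x.
Proof. by move=> inf [k o]; exact: inf (forced_numeric o). Qed.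

Lemma drawish_move (G : game) (x u : G) : move true x u -> drawish x -> drawish u.
Proof. by move=> m inf k f; apply: (inf k); apply: forced_move m f. Qed.

Lemma forced_uniq (G : game) (j k : nat) (x : G) :
  forced j x -> out false k x -> j = k.
Proof.
move=> f o; apply: contrapT => ne.
by apply: (out_excl (forced_out f (k := j) (j := k) _) o) => e; apply: ne.
Qed.

(** The shape that a win of [x + y + *k] must have when [y] is drawish: threats win outright in one
    component, or they bring [x] to a number [f] while [nimsum k f] is reached in [y]. *)
Definition cross (G1 G2 : game) (k : nat) (x : G1) (y : G2) : Prop :=
  [\/ full x, full y | exists2 f, forced f x & reached (nimsum k f) y].

Section Sum.
Variables (G1 G2 G : game) (l : G -> G1) (r : G -> G2) (ok : G -> Prop).
Hypothesis S : is_sum l r ok.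

(** Moves are answered in the component where they are made, and heap moves by [ltn_nimsum]. As
    either component may be moved, the induction on the left outcome contains one on the right
    outcome. *)
Lemma out_sum (c : bool) (a b : nat) (z : G) : ok z ->
  out c a (l z) -> out false b (r z) -> out c (nimsum a b) z.
Proof.
move=> + o; move ex: (l z) o => x o.
elim: o b z ex => {c a x}
  [a x w|a c x u m _ IH|a j x lt_ja _ IH|a x nw ns om IHm oh IHh] b z ex oz oy.
- by apply/out_wins/(sum_wins S oz); left; rewrite ex.
- rewrite -ex in m; have [z' [mz ez' rz']] := sum_left S oz m.
  apply: (out_move mz (IH _ _ ez' _ _)); last by rewrite rz'.
  by case: (sum_move S oz mz).
- apply: out_other (IH b z ex oz oy) _ => /nimsum_inj e.
  by rewrite e ltnn in lt_ja.
(* A quiet move on the right leaves it a win for the player to move, so the inner induction carries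
   an arbitrary outcome [d]. *)
suff inner d e y : out d e y -> forall z, ok z -> l z = x -> r z = y ->
  out d (nimsum a e) z by exact: inner oy z oz ex erefl.
move=> {b z ex oz} {}oy.
have ox : out false a x by exact: out_prev.
elim: oy => {d e y}
  [b y w|b d y v m _ IH|b j y lt_jb _ IH|b y nw' ns' om' IHm' oh' IHh'] z oz ex ey.
- by apply/out_wins/(sum_wins S oz); right; rewrite ey.
- rewrite -ey in m; have [z' [mz ez' rz']] := sum_right S oz m.
  have [oz' _] := sum_move S oz mz.
  by apply: out_move mz (IH _ oz' _ rz'); rewrite ez'.
- apply: out_other (IH z oz ex ey) _; rewrite ![nimsum a _]Nat.lxor_comm.
  by move=> /nimsum_inj eq_jb; rewrite eq_jb ltnn in lt_jb.
apply: out_prev => [/(sum_wins S oz)|/(sum_stalls S oz)|d z' mz|k /ltn_nimsum].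
- by rewrite ex ey => -[].
- by rewrite ex ey => -[].
- have [oz' [[m er]|[m el]]] := sum_move S oz mz.
    rewrite ex in m; apply: (IHm _ _ m) => //; rewrite er ey; exact: out_prev.
  by rewrite ey in m; apply: (IHm' _ _ m) => //; rewrite el.
case=> [lt_a|lt_b].
  have := IHh _ lt_a b z ex oz; rewrite nimsumK ey; apply.
  exact: out_prev.
by have := IHh' _ lt_b z oz ex ey; rewrite Nat.lxor_comm nimsumK.
Qed.

(** A converse of [out_sum]: a component that is the number [a] acts as the heap [*a]. The second
    claim is carried along because a quiet move in that component turns it into a win for the next
    player. *)
Lemma out_cancel (c : bool) (k : nat) (z : G) : out c k z -> ok z ->
  (forall a, out false a (l z) -> out c (nimsum k a) (r z)) /\
  (c = false -> forall a, out true a (l z) -> out true (nimsum k a) (r z)).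
Proof.
elim=> {c k z} [k z w|k c z z' mz _ IH|k j z lt_jk _ IH|k z nw ns om IHm oh IHh] oz.
- split=> // a o; case/(sum_wins S oz): w => [w|]; last exact: out_wins.
  by case/outPE: o.
- split=> // a o; have [oz' [[m er]|[m el]]] := sum_move S oz mz; last first.
    by apply: out_move m _; rewrite -el in o; apply: (IH oz').1 o.
  have [_ _ /(_ _ _ m) om _] := outPE o; rewrite -er.
  by case: c mz IH m om => mz IH m om; [exact: (IH oz').1 om | exact: (IH oz').2 om].
- split=> // a o; apply: out_other ((IH oz).1 a o) _ => /nimsum_inj e.
  by rewrite e ltnn in lt_jk.
have part2 : (forall a, out false a (l z) -> out false (nimsum k a) (r z)) ->
    forall a, out true a (l z) -> out true (nimsum k a) (r z).
  move=> part1 a /outNE[w|[b [u [m o]]]|[j lt_ja o]].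
  - by case: nw; apply/(sum_wins S oz); left.
  - have [z' [mz ez' <-]] := sum_left S oz m; have [oz' _] := sum_move S oz mz.
    rewrite -ez' in o.
    by case: b m mz o => m mz o; [exact: (IHm _ _ mz oz').2 o | exact: (IHm _ _ mz oz').1 o].
  - apply: out_other (part1 _ o) _; rewrite ![nimsum k _]Nat.lxor_comm.
    by move=> /nimsum_inj e; rewrite e ltnn in lt_ja.
suff part1 : forall a, out false a (l z) -> out false (nimsum k a) (r z).
  by split=> // _; exact: part2.
move=> a o; have [nwl nsl oml ohl] := outPE o.
apply: out_prev => [w|s|b v m|j /ltn_nimsum].
- by apply: nw; apply/(sum_wins S oz); right.
- by apply: ns; apply/(sum_stalls S oz); right.
- have [z' [mz el <-]] := sum_right S oz m; have [oz' _] := sum_move S oz mz.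
  by rewrite -el in o; apply: (IHm _ _ mz oz').1.
case=> [lt_k|lt_a]; first by have := (IHh _ lt_k oz).1 _ o; rewrite nimsumK.
(* The next player wins [l z] with the heap [nimsum j k], and not by a smaller heap, which would
   have to be [a] itself. The winning move is thus made in [l z], and induction carries the result
   to the right. *)
have := ohl _ lt_a => /outNE[//|[b [u [m ou]]]|[i lt_i oi]]; last first.
  have e := out_uniq o oi; rewrite e in lt_a.
  by have := ltn_trans lt_i lt_a; rewrite ltnn.
have [z' [mz el er]] := sum_left S oz m; have [oz' _] := sum_move S oz mz.
rewrite -el in ou; rewrite -er -(nimsumKl j k) (Nat.lxor_comm k j).
case: b m mz ou => m mz ou; last exact: (IHm _ _ mz oz').1 ou.
exact: (IHm _ _ mz oz').2 ou.
Qed.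

Lemma cross_step (k : nat) (z : G) : ok z -> drawish (r z) ->
  [\/ wins z,
      exists2 z', move false z z' & [/\ out false k z', numeric (l z') & numeric (r z')],
      exists2 z', move true z z' & drawish (r z') -> cross k (l z') (r z') |
      numeric (r z)] ->
  cross k (l z) (r z).
Proof.
move=> oz dr [w|[z' mz [o [a oa] nr]]|[z' mz IH]|/(drawish_nnumeric dr) //].
- by case/(sum_wins S oz): w => w; [apply: Or31 | apply: Or32]; exact: full_wins.
- have [oz' [[m er]|[m el]]] := sum_move S oz mz.
    by case: (drawish_nnumeric dr); rewrite -er.
  apply: Or33; exists a; first by apply: forced_numeric; rewrite -el.
  by apply: reached_numeric m _; have [+ _] := out_cancel o oz'; apply.
have [oz' [[m er]|[m el]]] := sum_move S oz mz.
  rewrite er in IH; case: (IH dr) => [f|f|[f ff rf]].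
  - by apply: Or31; apply: full_move m f.
  - exact: Or32.
  - by apply: Or33; exists f => //; apply: forced_move m ff.
rewrite el in IH; case: (IH (drawish_move m dr)) => [f|f|[f ff rf]].
- exact: Or31.
- by apply: Or32; apply: full_move m f.
- by apply: Or33; exists f => //; apply: reached_move m rf.
Qed.

End Sum.

(** Both claims need a common induction: a quiet winning move is read with the claim on numbers at
    its target, and a sum that is a number is analysed through [cross] after its quiet moves. *)
Lemma sum_out (G1 G2 G : game) (l : G -> G1) (r : G -> G2) (ok : G -> Prop)
    (c : bool) (k : nat) (z : G) : is_sum l r ok -> out c k z -> ok z ->
  if c then (drawish (r z) -> cross k (l z) (r z)) /\
            (drawish (l z) -> cross k (r z) (l z))
  else numeric (l z) /\ numeric (r z).
Proof.
move=> S; have S' := is_sumC S.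
elim=> {c k z} [k z w|k c z z' mz o IH|k j z lt_jk _ IH|k z nw ns om IHm oh IHh] oz.
- by split=> dr; [apply: (cross_step S) | apply: (cross_step S')] => //; apply: Or41.
- have [oz' _] := sum_move S oz mz; have {IH} := IH oz'.
  case: c mz o => mz o [H1 H2]; split=> dr;
    (apply: (cross_step S) || apply: (cross_step S')) => //;
    first [by apply: Or43; exists z' | by apply: Or42; exists z'].
- by case: (IH oz) => nl nr; split=> /drawish_nnumeric.
have o : out false k z by exact: out_prev.
case: (EM (numeric (l z))) => [[a oa]|nl].
  by split; [exists a | exists (nimsum k a); apply: (out_cancel S o oz).1].
case: (EM (numeric (r z))) => [[a oa]|nr].
  by split; [exists (nimsum k a); apply: (out_cancel S' o oz).1 | exists a].
(* A threat from [l z] would lead to a position of number [k] whose right component is still [r z];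
   by induction [r z] would be numeric. *)
have no_l u : ~ move true (l z) u.
  move=> m; have [z' [mz _ er]] := sum_left S oz m.
  have [oz' _] := sum_move S oz mz.
  by case: (IHm _ _ mz oz') => _; rewrite er.
have no_r u : ~ move true (r z) u.
  move=> m; have [z' [mz el _]] := sum_right S oz m.
  have [oz' _] := sum_move S oz mz.
  by case: (IHm _ _ mz oz'); rewrite el.
have nwl w : wins (l z) -> w by move=> w'; case: nw; apply/(sum_wins S oz); left.
have nwr w : wins (r z) -> w by move=> w'; case: nw; apply/(sum_wins S oz); right.
have nfl : ~ full (l z).
  by move=> f; case: f nwl no_l => [x w|x u m _] nwl no_l; [exact: nwl w | exact: no_l m].
have nfr : ~ full (r z).
  by move=> f; case: f nwr no_r => [x w|x u m _] nwr no_r; [exact: nwr w | exact: no_r m].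
have dl : drawish (l z).
  by move=> j f; case: f nl no_l => [x oj|x u m _] nl no_l; [apply: nl; exists j | exact: no_l m].
have dr : drawish (r z).
  by move=> j f; case: f nr no_r => [x oj|x u m _] nr no_r; [apply: nr; exists j | exact: no_r m].
have [M lt_M] := numeric_bound G1.
have [m [nm lt_m]] : exists m, is_mex (fun j => exists2 u, move false (l z) u & out false j u) m.
  by apply: (@exists_mex _ M) => -[u _ /lt_M]; rewrite ltnn.
(* Otherwise every quiet move leaves a win at [m] and, in the absence of threats, wins and stalls,
   [l z] would be the number [m]. *)
have [u mu nu] : exists2 u, move false (l z) u & ~ out true m u.
  apply: contrapT => nex; apply: nl; exists m; apply: out_prev.
  - exact: nwl.
  - by move=> s; apply: ns; apply/(sum_stalls S oz); left.
  - case=> u mu; first by case: (no_l u).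
    by apply: contrapT => nu; apply: nex; exists u.
  - by move=> j /lt_m[u mu ou]; apply: out_move mu ou.
have [z' [mz el er]] := sum_left S oz mu; have [oz' _] := sum_move S oz mz.
have [] := IHm _ _ mz oz'; rewrite /= el er => /(_ dr) [f|//|[f ff rf]] _.
  by case: nu; exact: full_out.
(* By [forced_out], [u] is a win with every heap other than [f]. *)
have e : f = m by apply: contrapT => ne; apply: nu; apply: forced_out ff _ => e; apply: ne.
move: rf; rewrite e => rf.
have [v mv ov] : exists2 v, move false (r z) v & out false (nimsum k m) v.
  case: rf nwr no_r => [y w|y v mv ov|y v mv _] nwr no_r.
  - exact: nwr.
  - by exists v.
  - by case: (no_r v).
have [z'' [mz' el' er']] := sum_right S oz mv; have [oz'' _] := sum_move S oz mz'.
have [] := IHm _ _ mz' oz''; rewrite /= el' er' => _ /(_ dl) [fv|//|[f' ff' rf']].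
  by case: (full_nnumeric fv); exists (nimsum k m).
(* The number of [v] is its only forced value, so the refutation reaches [m] in [l z]. Without
   threats and wins there, this is a quiet move to [m], against the choice of [m] as a mex. *)
rewrite (forced_uniq ff' ov) nimsumKl in rf'; case: nm.
case: rf' nwl no_l => [y w|y v' mv' ov'|y v' mv' _] nwl no_l.
- exact: nwl.
- by exists v'.
- by case: (no_l v').
Qed.

(** * The values of a sum *)

Section SumValues.
Variables (G1 G2 G : game) (l : G -> G1) (r : G -> G2) (ok : G -> Prop).
Hypothesis S : is_sum l r ok.

Lemma full_sum_left (z : G) : ok z -> full (l z) -> full z.
Proof.
move=> + f; move ex: (l z) f => x f; elim: f z ex => {x} [x w|x u m _ IH] z ex oz.
  by apply/full_wins/(sum_wins S oz); left; rewrite ex.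
rewrite -ex in m; have [z' [mz ez' _]] := sum_left S oz m.
by apply: (full_move mz); apply: IH => //; case: (sum_move S oz mz).
Qed.

Lemma full_sum (z : G) : full z -> ok z -> full (l z) \/ full (r z).
Proof.
elim=> {z} [z w|z z' mz _ IH] oz.
  by case/(sum_wins S oz): w => w; [left | right]; exact: full_wins.
have [oz' [[m er]|[m el]]] := sum_move S oz mz; case: (IH oz') => f.
- by left; apply: full_move m f.
- by right; rewrite -er.
- by left; rewrite -el.
- by right; apply: full_move m f.
Qed.

Lemma numeric_sum (k : nat) (z : G) : out false k z -> ok z ->
  exists a b, [/\ out false a (l z), out false b (r z) & k = nimsum a b].
Proof.
move=> o oz; have [[a oa] [b ob]] := sum_out S o oz; exists a, b; split=> //.
exact: out_uniq o (out_sum S oz oa ob).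
Qed.

Lemma forced_sum (k : nat) (z : G) : forced k z -> ok z ->
  exists a b, [/\ forced a (l z), forced b (r z) & k = nimsum a b].
Proof.
elim=> {z} [z o|z z' mz _ IH] oz.
  have [a [b [oa ob e]]] := numeric_sum o oz.
  by exists a, b; split=> //; exact: forced_numeric.
have [oz' [[m e]|[m e]]] := sum_move S oz mz; have [a [b [fa fb ->]]] := IH oz';
  exists a, b; split=> //; rewrite -?e //.
- exact: forced_move m fa.
- exact: forced_move m fb.
Qed.

Lemma forced_sum_intro (a b : nat) (z : G) : ok z ->
  forced a (l z) -> forced b (r z) -> forced (nimsum a b) z.
Proof.
move=> + f; move ex: (l z) f => x f; elim: f z ex => {x} [x oa|x u m _ IH] z ex oz fb.
  move ey: (r z) fb => y fb; elim: fb z ex ey oz => {y} [y ob|y v m _ IH] z ex ey oz.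
    by apply: forced_numeric; apply: (out_sum S); rewrite ?ex ?ey.
  rewrite -ey in m; have [z' [mz el er]] := sum_right S oz m.
  apply: (forced_move mz); apply: IH => //; first by rewrite el.
  by case: (sum_move S oz mz).
rewrite -ex in m; have [z' [mz el er]] := sum_left S oz m.
by apply: (forced_move mz); apply: IH; rewrite ?er //; case: (sum_move S oz mz).
Qed.

(** Threats on the right are played first, down to the number [f]; the steps on the left are then
    repeated in the sum. *)
Lemma reached_sum_intro (j f : nat) (z : G) : ok z ->
  reached j (l z) -> forced f (r z) -> reached (nimsum j f) z.
Proof.
move=> + + fy; move ey: (r z) fy => y fy.
elim: fy z ey => {y} [y o|y v m _ IH] z ey oz rx; last first.
  rewrite -ey in m; have [z' [mz el er]] := sum_right S oz m.
  apply: (reached_move mz); apply: IH => //; last by rewrite el.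
  by case: (sum_move S oz mz).
move ex: (l z) rx => x rx.
elim: rx z ex ey oz => {x} [x w|x u m ou|x u m _ IH] z ex ey oz.
- by apply: reached_wins; apply/(sum_wins S oz); left; rewrite ex.
- rewrite -ex in m; have [z' [mz el er]] := sum_left S oz m.
  have [oz' _] := sum_move S oz mz.
  by apply: (reached_numeric mz); apply: (out_sum S oz'); rewrite ?el ?er ?ey.
- rewrite -ex in m; have [z' [mz el er]] := sum_left S oz m.
  have [oz' _] := sum_move S oz mz.
  by apply: (reached_move mz); apply: IH; rewrite ?er.
Qed.

Lemma moonish_sum_intro (f : nat) (z : G) : ok z ->
  moonish (l z) -> forced f (r z) -> moonish z.
Proof.
move=> + + fy; move ey: (r z) fy => y fy.
elim: fy z ey => {y} [y o|y v m _ IH] z ey oz mx; last first.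
  rewrite -ey in m; have [z' [mz el er]] := sum_right S oz m.
  apply: (moonish_move mz); apply: IH => //; last by rewrite el.
  by case: (sum_move S oz mz).
move ex: (l z) mx => x mx.
elim: mx z ex ey oz => {x} [x base|x u m _ IH] z ex ey oz; last first.
  rewrite -ex in m; have [z' [mz el er]] := sum_left S oz m.
  have [oz' _] := sum_move S oz mz.
  by apply: (moonish_move mz); apply: IH; rewrite ?er.
rewrite -ex in base; apply: moonish_base => k.
case: (base (nimsum k f)) => [[u m ou]|[u [j [m oj ne]]]].
  have [z' [mz el er]] := sum_left S oz m; have [oz' _] := sum_move S oz mz.
  left; exists z' => //; rewrite -(nimsumK k f).
  by apply: (out_sum S oz'); rewrite ?el ?er ?ey.
have [z' [mz el er]] := sum_left S oz m; have [oz' _] := sum_move S oz mz.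
right; exists z', (nimsum j f); split=> //.
  by apply: (out_sum S oz'); rewrite ?el ?er ?ey.
by move=> e; apply: ne; rewrite -e nimsumK.
Qed.

(** [l z] is not a number, or [z] would be one too. Hence every move to a number is made on the
    left, and the number of [r z] merely shifts [k]. *)
Lemma moonish_sum_base (z : G) : ok z ->
  (forall k, (exists2 u, move false z u & out false k u) \/
      exists u j, [/\ move true z u, out false j u & j <> k]) ->
  numeric (r z) -> moonish (l z).
Proof.
move=> oz base [b ob]; have mz := moonish_base base.
have nl j : ~ out false j (l z).
  by move=> o; apply: (moonish_nnumeric mz); exists (nimsum j b); apply: (out_sum S).
apply: moonish_base => k.
case: (base (nimsum k b)) => [[z' m o]|[z' [j [m o ne]]]];
  have [oz' [[m' e]|[m' e]]] := sum_move S oz m;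
  have [a' [b' [oa' ob' ek]]] := numeric_sum o oz'; try by case: (nl a'); rewrite -e.
  left; exists (l z') => //; rewrite e in ob'; rewrite (out_uniq ob' ob) in ek.
  by rewrite (nimsum_inj ek).
right; exists (l z'), a'; split=> // ea; apply: ne.
by rewrite e in ob'; rewrite ek ea (out_uniq ob' ob).
Qed.

End SumValues.

Lemma moonish_sum (G1 G2 G : game) (l : G -> G1) (r : G -> G2) (ok : G -> Prop)
    (z : G) : is_sum l r ok -> moonish z -> ok z ->
  moonish (l z) /\ (exists f, forced f (r z)) \/
  moonish (r z) /\ (exists f, forced f (l z)).
Proof.
move=> S; elim=> {z} [z base|z z' mz _ IH] oz; last first.
  have [oz' [[m e]|[m e]]] := sum_move S oz mz; case: (IH oz') => -[mo [f ff]].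
  - by left; split; [exact: moonish_move m mo | exists f; rewrite -e].
  - by right; split; [rewrite -e | exists f; apply: forced_move m ff].
  - by left; split; [rewrite -e | exists f; apply: forced_move m ff].
  - by right; split; [exact: moonish_move m mo | exists f; rewrite -e].
have [M lt_M] := numeric_bound G.
(* At [k := M] only a threat to a number remains; the component that it does not touch is
   numeric. *)
case: (base M) => [[u _ /lt_M]|[z' [j [m o _]]]]; first by rewrite ltnn.
have [oz' [[m' e]|[m' e]]] := sum_move S oz m; have [a [b [oa ob _]]] := numeric_sum S o oz'.
- rewrite e in ob; left; split; last by exists b; exact: forced_numeric.
  by apply: (moonish_sum_base S oz base); exists b.
- rewrite e in oa; right; split; last by exists a; exact: forced_numeric.
  by apply: (moonish_sum_base (is_sumC S) oz base); exists a.
Qed.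

(** * Grundy values through fixed points, and the addition table *)

Local Open Scope classical_set_scope.

(** The moon excludes [full] explicitly, since [moonish] allows it. [drawish] rules out both
    [moonish] and [numeric], as each of these yields a forced value. *)
Definition has_value (G : game) (x : G) (g : gvalue) : Prop :=
  match g with
  | GNum n => out false n x
  | GFull => full x
  | GMoon F => [/\ ~ full x, moonish x & [set k | forced k x] = F]
  | GNym f => [/\ ~ full x, ~ moonish x, ~ numeric x & [set k | forced k x] = [set f]]
  | GInf D => [/\ ~ full x, drawish x & [set k | reached k x] = D]
  end.

Lemma nim_setsumC (A B : set nat) : nim_setsum A B = nim_setsum B A.
Proof.
by apply/seteqP; split=> k /= [a Aa [b Bb <-]]; exists b => //; exists a => //;
  rewrite Nat.lxor_comm.
Qed.

Lemma nim_setsum1l (a : nat) (B : set nat) : nim_setsum [set a] B = nim_shift a B.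
Proof.
by apply/seteqP; split=> k /= [b]; [move=> -> | move=> Bb <-; exists a => //; exists b].
Qed.

Lemma nim_setsum11 (a b : nat) : nim_setsum [set a] [set b] = [set nimsum a b].
Proof. by rewrite nim_setsum1l /nim_shift image_set1. Qed.

Lemma gsumC (g h : gvalue) : gsum g h = gsum h g.
Proof.
by case: g h => [n||F|f|D] [n'||F'|f'|D'] //=;
  rewrite ?(Nat.lxor_comm n) ?(Nat.lxor_comm f) // nim_setsumC.
Qed.

Lemma numeric_forced (G : game) (n : nat) (x : G) :
  out false n x -> [set k | forced k x] = [set n].
Proof.
move=> o; apply/seteqP; split=> k /= => [f|->]; first exact: forced_uniq f o.
exact: forced_numeric.
Qed.

Section SumTable.
Variables (G1 G2 G : game) (l : G -> G1) (r : G -> G2) (ok : G -> Prop).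
Hypothesis S : is_sum l r ok.

Lemma forced_set_sum (z : G) : ok z ->
  [set k | forced k z] = nim_setsum [set k | forced k (l z)] [set k | forced k (r z)].
Proof.
move=> oz; apply/seteqP; split=> k /=.
  by move=> /(forced_sum S)/(_ oz) [a [b [fa fb ->]]]; exists a => //; exists b.
by move=> [a fa [b fb <-]]; exact: (forced_sum_intro S).
Qed.

Lemma nfull_sum (z : G) : ok z -> ~ full (l z) -> ~ full (r z) -> ~ full z.
Proof. by move=> oz nl nr /(full_sum S)/(_ oz)[]. Qed.

(** One formula covers the row: the forced values of [r z] form [F'], a singleton, or the empty set,
    the last giving [GInf set0]. Nothing else is reached, because a reached value is a win and so
    has the shape [cross]. *)
Lemma value_sum_drawish (D : set nat) (z : G) : ok z -> ~ full (r z) ->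
  has_value (l z) (GInf D) ->
  has_value z (GInf (nim_setsum D [set k | forced k (r z)])).
Proof.
move=> oz nfr [nfl dl <-]; split; first exact: nfull_sum.
  by move=> k /(forced_sum S)/(_ oz)[a [b [/dl]]].
apply/seteqP; split=> k /=; last first.
  by move=> [j rj [f ff <-]]; exact: (reached_sum_intro S).
move=> /reached_out o; have [_ /(_ dl) []//] := sum_out S o oz.
by case=> f ff rf; exists (nimsum k f) => //; exists f => //; rewrite nimsumK.
Qed.

Lemma value_sum_moonish (F : set nat) (z : G) : ok z -> ~ full (r z) -> ~ drawish (r z) ->
  has_value (l z) (GMoon F) ->
  has_value z (GMoon (nim_setsum F [set k | forced k (r z)])).
Proof.
move=> oz nfr ndr [nfl ml <-]; split; first exact: nfull_sum.
  have [f ff] : exists f, forced f (r z).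
    by apply: contrapT => nex; apply: ndr => k fk; apply: nex; exists k.
  exact: (moonish_sum_intro S) ff.
exact: forced_set_sum.
Qed.

Lemma value_sum_nym (f f' : nat) (z : G) : ok z ->
  has_value (l z) (GNym f) -> ~ full (r z) -> ~ moonish (r z) ->
  [set k | forced k (r z)] = [set f'] -> has_value z (GNym (nimsum f f')).
Proof.
move=> oz [nfl nml nnl fl] nfr nmr fr; split; first exact: nfull_sum.
- by move=> /(moonish_sum S)/(_ oz)[[]|[]].
- by case=> k /(numeric_sum S)/(_ oz)[a [b [oa _ _]]]; apply: nnl; exists a.
- by rewrite forced_set_sum // fl fr nim_setsum11.
Qed.

End SumTable.

(** The table is symmetric, so only the entries whose left value dominates have to be treated. *)
Definition gvalue_rank (g : gvalue) : nat :=
  match g with GFull => 4 | GInf _ => 3 | GMoon _ => 2 | GNym _ => 1 | GNum _ => 0 end.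

Lemma value_sum_le (G1 G2 G : game) (l : G -> G1) (r : G -> G2) (ok : G -> Prop)
    (z : G) (g h : gvalue) : is_sum l r ok -> ok z -> gvalue_rank h <= gvalue_rank g ->
  has_value (l z) g -> has_value (r z) h -> has_value z (gsum g h).
Proof.
move=> S oz.
have neq0 (A : set nat) k : A k -> [set k | forced k (r z)] = A -> ~ drawish (r z).
  by move=> Ak e d; move: Ak; rewrite -e => /d.
case: g => [n||F|f|D]; case: h => [n'||F'|f'|D'] // _ vl vr.
- exact: (out_sum S).
- exact: (full_sum_left S).
- exact: (full_sum_left S).
- exact: (full_sum_left S).
- exact: (full_sum_left S).
- exact: (full_sum_left S).
- have e := numeric_forced vr; rewrite /= -nim_setsum1l nim_setsumC -e.
  apply: (value_sum_moonish S) => //; last exact: neq0 e.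
  by move/full_nnumeric; apply; exists n'.
- have [nfr mr <-] := vr; apply: (value_sum_moonish S) => //.
  by have [k fk] := moonish_forced mr; apply: neq0 fk erefl.
- have [nfr mr nnr e] := vr; rewrite /= -nim_setsum1l nim_setsumC -e.
  by apply: (value_sum_moonish S) => //; exact: neq0 e.
- apply: (value_sum_nym S) => //; last exact: numeric_forced.
    by move/full_nnumeric; apply; exists n'.
  by move/moonish_nnumeric; apply; exists n'.
- by have [nfr mr nnr e] := vr; exact: (value_sum_nym S).
- rewrite /= -nim_setsum1l nim_setsumC -(numeric_forced vr).
  by apply: (value_sum_drawish S) => //; move/full_nnumeric; apply; exists n'.
- by have [nfr mr <-] := vr; exact: (value_sum_drawish S).
- have [nfr mr nnr e] := vr; rewrite /= -nim_setsum1l nim_setsumC -e.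
  exact: (value_sum_drawish S).
- have [nfr dr _] := vr; have := value_sum_drawish S oz nfr vl.
  have -> : [set k | forced k (r z)] = set0 by apply/seteqP; split=> k //= /dr.
  by have -> : nim_setsum D set0 = set0 by apply/seteqP; split=> k //= [a _ [b]].
Qed.

Lemma value_sum (G1 G2 G : game) (l : G -> G1) (r : G -> G2) (ok : G -> Prop)
    (z : G) (g h : gvalue) : is_sum l r ok -> ok z ->
  has_value (l z) g -> has_value (r z) h -> has_value z (gsum g h).
Proof.
move=> S oz vl vr; case: (leqP (gvalue_rank h) (gvalue_rank g)) => [le|/ltnW le].
  exact: (value_sum_le S).
by rewrite gsumC; apply: (value_sum_le (is_sumC S)).
Qed.

(** * The algorithm on a contracted digraph *)

(* [lead b y u]: from [y] the moves are forced down to the white node [u], and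
   [b] is the parity of their number. *)
Inductive lead (V : digraph) : bool -> V -> V -> Prop :=
  | lead_white (u : V) of white u : lead false u u
  | lead_gray b (y z u : V) of gray y & arc y z & lead b z u : lead (~~ b) y u.

(* [dead_end b y]: the moves from [y] are forced down to a gray terminal node,
   and [b] tells whether the player who moved to [y] wins. *)
Inductive dead_end (V : digraph) : bool -> V -> Prop :=
  | dead_end_terminal (y : V) of gray y & (forall z, ~ arc y z) : dead_end true y
  | dead_end_gray b (y z : V) of gray y & arc y z & dead_end b z : dead_end (~~ b) y.

(** Gray nodes stay in the carrier, but only white positions matter. A move into a run with
    [dead_end false] loses at once and is recorded neither as a move, nor as a win, nor as a
    stall. *)
Canonical contracted (V : digraph) : game := {|
  pos := V;
  move := fun b x u => exists2 y, arc x y & lead b y u;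
  wins := fun x => exists2 y, arc x y & dead_end true y;
  stalls := fun x => exists y,
    [/\ arc x y, forall b u, ~ lead b y u & forall b, ~ dead_end b y]
|}.

Scheme Cr_mut := Minimality for Cr Sort Prop
  with Cr_option_mut := Minimality for Cr_option Sort Prop.
Combined Scheme Cr_both_ind from Cr_mut, Cr_option_mut.

Lemma mexP (A : set nat) : A <> setT -> is_mex A (mex A).
Proof.
move=> nT; apply: xgetPex.
have [M nAM] : exists M, ~ A M.
  by apply: contrapT => nex; apply: nT; apply/seteqP; split=> k // _;
    apply: contrapT => nA; apply: nex; exists k.
exact: exists_mex nAM.
Qed.

Lemma mexE (A : set nat) (m : nat) : is_mex A m -> mex A = m.
Proof.
move=> [nAm lt_m]; have [|nAM lt_M] := @mexP A; first by move=> e; apply: nAm; rewrite e.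
by case: (ltngtP (mex A) m) => // [/lt_m|/lt_M].
Qed.

(** * Runs of gray nodes *)

Section Chains.
Variable V : digraph.
Hypothesis hV : gray_outdegree_le1 V.
Implicit Types (x y z u : V) (b c : bool) (k m n : nat).

Lemma gray_arc_uniq x y z : gray x -> arc x y -> arc x z -> y = z.
Proof. by move=> /hV/card_le1_eqP H xy xz; apply: H. Qed.

Lemma white_gray x : white x -> gray x -> False.
Proof. by rewrite /white => /negP. Qed.

Lemma white_or_gray x : white x \/ gray x.
Proof. by rewrite /white; case: (gray x); [right | left]. Qed.

Lemma lead_target b y u : lead b y u -> white u.
Proof. by elim. Qed.

Lemma lead_option x y : gray x -> arc x y -> white y -> lead true x y.
Proof. by move=> gx xy wy; apply: (lead_gray gx xy (lead_white wy)). Qed.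

Lemma leadE b y u : lead b y u ->
  [/\ white y, b = false & u = y] \/
  exists z, [/\ gray y, arc y z & lead (~~ b) z u].
Proof.
case=> {b y u} [u wu|b y z u gy yz le]; first by left.
by right; exists z; rewrite negbK.
Qed.

Lemma dead_endE b y : dead_end b y -> gray y /\
  ((b = true /\ forall z, ~ arc y z) \/ exists z, arc y z /\ dead_end (~~ b) z).
Proof.
case=> {b y} [y gy ny|b y z gy yz d]; split=> //; first by left.
by right; exists z; rewrite negbK.
Qed.

Lemma lead_det b c y u z : lead b y u -> lead c y z -> b = c /\ u = z.
Proof.
move=> le; elim: le c z => {b y u} [u wu|b y t u gy yt _ IH] c z /leadE.
  by case=> [[_ -> ->] //|[t [/(white_gray wu)]]].
case=> [[/white_gray/(_ gy)] //|[t' [_ yt' le']]].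
rewrite -(gray_arc_uniq gy yt yt') in le'.
by have [-> ->] := IH _ _ le'; rewrite negbK.
Qed.

Lemma lead_dead_end b c y u : lead b y u -> ~ dead_end c y.
Proof.
move=> le; elim: le c => {b y u} [u wu|b y t u gy yt _ IH] c /dead_endE[].
  by move/(white_gray wu).
move=> _ [[_ /(_ _ yt)] //|[z [yz d]]].
by rewrite -(gray_arc_uniq gy yt yz) in d; exact: IH d.
Qed.

Lemma dead_end_det b c y : dead_end b y -> dead_end c y -> b = c.
Proof.
move=> d; elim: d c => {b y} [y gy ny|b y z gy yz _ IH] c /dead_endE[_].
  by case=> [[->] //|[z [/ny]]].
case=> [[_ /(_ _ yz)] //|[t [yt d]]].
by rewrite -(gray_arc_uniq gy yz yt) in d; rewrite (IH _ d) negbK.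
Qed.

(* [out] extended to gray nodes: it describes who wins y + *k when the play is
   at [y]. *)
Definition outcome c k y : Prop :=
  dead_end (~~ c) y \/ exists b u, lead b y u /\ out (c (+) b) k u.

Lemma outcome_white c k y : white y -> outcome c k y <-> out c k y.
Proof.
move=> wy; split=> [[/dead_endE[/(white_gray wy)] //|[b [u [/leadE le o]]]]|o]; last first.
  by right; exists false, y; rewrite addbF; split=> //; exact: lead_white.
by case: le o => [[_ -> ->]|[z [/(white_gray wy)]]] //; rewrite addbF.
Qed.

Lemma outcome_gray c k y z : gray y -> arc y z -> outcome c k z -> outcome (~~ c) k y.
Proof.
move=> gy yz [d|[b [u [le o]]]]; first by left; exact: dead_end_gray yz d.
by right; exists (~~ b), u; rewrite addNb addbN negbK; split=> //; exact: lead_gray yz le.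
Qed.

Lemma outcome_excl c k y : outcome c k y -> ~ outcome (~~ c) k y.
Proof.
move=> [d|[b [u [le o]]]] [d'|[b' [u' [le' o']]]].
- by have := dead_end_det d d'; case: (c).
- exact: lead_dead_end le' d.
- exact: lead_dead_end le d'.
- have [eb eu] := lead_det le le'; subst b' u'.
  by apply: (out_excl o); rewrite -addNb.
Qed.

Lemma outcome_move k x y : arc x y -> outcome false k y -> out true k x.
Proof.
move=> xy [d|[b [u [le o]]]]; first by apply: out_wins; exists y.
by apply: (@out_move _ _ b _ u) o; exists y.
Qed.

Lemma outcome_reply k y z : arc y z -> outcome false k z -> outcome true k y.
Proof.
move=> yz o; case: (white_or_gray y) => [wy|gy]; last exact: outcome_gray yz o.
by apply/outcome_white => //; apply: outcome_move yz o.
Qed.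

Lemma outcome_prev k x : (forall y, arc x y -> outcome true k y) ->
  (forall j, j < k -> out true j x) -> out false k x.
Proof.
move=> ho hh; apply: out_prev => // [[y xy d]|[y [xy nl nd]]|b u [y xy le]].
- by apply: (outcome_excl (ho y xy)); left.
- by case: (ho y xy) => [/nd|[b [u [/nl]]]].
- case: (ho y xy) => [d|[b' [u' [le' o]]]]; first by case: (lead_dead_end le d).
  by have [-> ->] := lead_det le le'.
Qed.

Lemma outcome_prevE k x y : out false k x -> arc x y -> outcome true k y.
Proof.
move=> /outPE[nw ns om _] xy; case: (EM (exists b u, lead b y u)) => [[b [u le]]|nl].
  by right; exists b, u; split=> //; apply: om; exists y.
case: (EM (exists b, dead_end b y)) => [[[] d]|nd]; last 1 first.
- case: ns; exists y; split=> // [b u le|b d]; first by apply: nl; exists b, u.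
  by apply: nd; exists b.
- by case: nw; exists y.
- by left.
Qed.

(** The meaning of [New] ([b] true) and [Full] ([b] false): threats and gray terminal nodes settle
    the winner, whatever heap is added. *)
Definition won b y : Prop := dead_end b y \/ exists2 u, lead b y u & full u.

Lemma won_outcome b k y : won b y -> outcome (~~ b) k y.
Proof.
move=> [d|[u le f]]; first by left; rewrite negbK.
by right; exists b, u; rewrite addNb addbb; split=> //; exact: full_out.
Qed.

Lemma won_gray b y z : gray y -> arc y z -> won b z -> won (~~ b) y.
Proof.
move=> gy yz [d|[u le f]]; first by left; exact: dead_end_gray yz d.
by right; exists u => //; exact: lead_gray yz le.
Qed.

Lemma won_white y : white y -> full y -> won false y.
Proof. by move=> wy f; right; exists y => //; exact: lead_white. Qed.

Lemma won_full y : white y -> won false y -> full y.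
Proof.
move=> wy [/dead_endE[/(white_gray wy)] //|[u /leadE[[_ _ ->] //|[z [/(white_gray wy)]]]]] //.
Qed.

Lemma won_true_gray y : won true y -> gray y.
Proof. by case=> [/dead_endE[]|[u /leadE[[//]|[z []]]]]. Qed.

Lemma won_option x y : arc x y -> won true y -> full x.
Proof.
move=> xy [d|[u le f]]; first by apply: full_wins; exists y.
by apply: full_move f; exists y.
Qed.

(** The heaps with which the previous player wins at [u], in the two cases from which set labels
    arise. A set label is this set or its complement, according to the parity of the run. *)
Definition prev_set u (B : set nat) : Prop :=
  (exists2 k, out false k u & B = [set k]) \/ (moonish u /\ B = set0).

Lemma prev_setP u B k : prev_set u B -> (B k -> out false k u) /\ (~ B k -> out true k u).
Proof.
case=> [[j o ->]|[m ->]]; last by split=> // _; exact: moonish_out.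
by split=> /= [->|ne] //; apply: out_other o _.
Qed.

Lemma prev_set_uniq u B B' : prev_set u B -> prev_set u B' -> B = B'.
Proof.
move=> [[k o ->]|[m ->]] [[k' o' ->]|[m' ->]] //.
- by rewrite (out_uniq o o').
- by case: (moonish_nnumeric m'); exists k.
- by case: (moonish_nnumeric m); exists k'.
Qed.

(** The invariant of the algorithm. [Moon] promises only [moonish], since [Full] may still overwrite
    it; likewise a set label may give way to [New] or [Full]. *)
Definition sound (a : label) y : Prop :=
  match a with
  | Unassigned => True
  | Num k => white y /\ out false k y
  | Full => won false y
  | New => won true y
  | Moon => white y /\ moonish y
  | NatSet A => gray y /\ exists b u B,
      [/\ lead b y u, prev_set u B & A = if b then ~` B else B]
  end.

(* The [k] for which moving to a node labelled [a] wins in the sum with *k. *)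
Definition heaps (a : label) : set nat :=
  match a with
  | Num k => [set k]
  | NatSet A => A
  | New => setT
  | _ => set0
  end.

Lemma sound_heaps a k y : a <> Unassigned -> sound a y ->
  (heaps a k -> outcome false k y) /\ (~ heaps a k -> outcome true k y).
Proof.
case: a => [j|A||||] //= _.
- case=> wy o; split=> [->|ne]; apply/outcome_white => //; exact: out_other o _.
- case=> _ [b [u [B [le pB ->]]]]; have [B1 B2] := prev_setP k pB.
  by case: b le => le; split=> h; right; [exists true | exists true | exists false | exists false];
    exists u; split=> //=; [apply: B2 | apply: B1; apply: contrapT | apply: B1 | apply: B2].
- by move=> w; split=> // _; exact: won_outcome w.
- by case=> wy m; split=> // _; apply/outcome_white => //; exact: moonish_out.
- by move=> w; split=> // _; exact: won_outcome w.
Qed.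

Lemma sound_uniq a a' y : sound a y -> sound a' y ->
  a <> Unassigned -> a' <> Unassigned -> (forall b, ~ won b y) -> a = a'.
Proof.
case: a => [k|A||||] //= s; case: a' => [k'|A'||||] //= s' _ _ nw;
  try (by case: (nw _ s)); try (by case: (nw _ s')).
- by rewrite (out_uniq s.2 s'.2).
- by case: s s' => w _ [/(white_gray w)].
- by case: (moonish_nnumeric s'.2); exists k; case: s.
- by case: s' s => w _ [/(white_gray w)].
- case: s s' => _ [b [u [B [le pB ->]]]] [_ [b' [u' [B' [le' pB' ->]]]]].
  have [eb eu] := lead_det le le'; subst b' u'.
  by rewrite (prev_set_uniq pB pB').
- by case: s' s => w _ [/(white_gray w)].
- by case: (moonish_nnumeric s.2); exists k'; case: s'.
- by case: s' s => g _ [/white_gray/(_ g)].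
Qed.

(** * Soundness of the labels *)

Section Sound.
Variable L : V -> label.
Hypothesis sL : forall y, sound (L y) y.

Lemma Cr_sound k : (forall x, Cr L k x -> outcome false k x) /\
  (forall y, Cr_option L k y -> outcome true k y).
Proof.
apply: Cr_both_ind => [x gx _ IH|y wy h|y z yz wz e|y z yz gz _ o].
- case: (EM (exists y, arc x y)) => [[y xy]|nx].
    exact: (outcome_gray gx xy (IH y xy)).
  by left; apply: dead_end_terminal => // z xz; apply: nx; exists z.
- have := sL y; case: h => [->|->|[j -> ne]] s; apply: (sound_heaps k _ s).2 => //=.
  by move=> e; apply: ne.
- by apply: (outcome_reply yz); apply: (sound_heaps k _ (sL z)).1; rewrite e.
- exact: outcome_reply yz o.
Qed.

Lemma option_set_outcome x k :
  (white_option_labels L x `|` gray_option_union L x) k ->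
  exists2 y, arc x y & outcome false k y.
Proof.
case=> [[y [xy wy e]]|[y [A [xy gy e Ak]]]]; exists y => //;
  by apply: (sound_heaps k _ (sL y)).1; rewrite e.
Qed.

Lemma white_step_sound x : white x -> sound (white_step L x) x.
Proof.
move=> wx; rewrite /white_step; set A := _ `|` _.
case: asboolP => [[y [xy gy e]]|nnew].
  by apply: won_white => //; apply: (won_option xy); have := sL y; rewrite e.
case: asboolP => [eA|/mexP[nAm ltAm]].
  (* A threat to a moonish node suffices. If there is none, each set contributed by a threat is the
     complement of a number, as the base case requires. *)
  split=> //; case: (EM (exists u, move true x u /\ moonish u)) => [[u [m mu]]|nm].
    exact: moonish_move m mu.
  apply: moonish_base => k; have : A k by rewrite eA.
  case=> [[y [xy wy e]]|[y [B [xy gy e Bk]]]]; have := sL y; rewrite e.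
    by case=> _ o; left; exists y => //; exists y => //; exact: lead_white.
  case=> _ [b [u [B' [le pB eB]]]]; rewrite eB in Bk.
  have mv : move b x u by exists y.
  case: b le Bk mv {eB} => le Bk mv.
    case: pB Bk => [[j o ->] ne|[mu _] _]; last by case: nm; exists u.
    by right; exists u, j; split=> // e'; apply: ne.
  by left; exists u => //; apply: (prev_setP k pB).1.
case: asboolP => // rev; split=> //; apply: outcome_prev => [y xy|j /ltAm].
  case: (EM (L y = Unassigned)) => [/(rev y xy)[z yz [[wz e]|[gz cr]]]|ny].
  - by apply: (outcome_reply yz); apply: (sound_heaps _ _ (sL z)).1; rewrite e.
  - exact: (outcome_reply yz ((Cr_sound _).1 _ cr)).
  - apply: (sound_heaps _ ny (sL y)).2 => h; have s := sL y.
    case e : (L y) s h ny => [k|B||||] //= s h _.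
    + by apply: nAm; left; exists y; split=> //; [case: s | rewrite e h].
    + by apply: nAm; right; exists y, B; split=> //; case: s.
    + by apply: nnew; exists y; split=> //; exact: won_true_gray s.
by move=> /option_set_outcome[y xy o]; exact: outcome_move xy o.
Qed.

Lemma gray_step_sound x : gray x -> sound (gray_step L x) x.
Proof.
move=> gx; rewrite /gray_step; case: pickP => [y xy|_]; last exact: sL.
have := sL y; case: ifP => wy; case: (L y) => [k|A||||] //= s; try exact: sL.
- split=> //; exists true, y, [set k]; split=> //.
    by apply: lead_option => //; case: s.
  by left; exists k => //; case: s.
- exact: won_gray gx xy s.
- split=> //; exists true, y, set0; split; last by rewrite setC0.
    by apply: lead_option => //; case: s.
  by right; case: s.
- split=> //; case: s => _ [b [u [B [le pB ->]]]]; exists (~~ b), u, B; split=> //.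
    exact: lead_gray gx xy le.
  by case: (b) => //=; rewrite setCK.
- exact: won_gray gx xy s.
- exact: won_gray gx xy s.
Qed.

Lemma step_sound y : sound (step L y) y.
Proof.
rewrite /step; case: ifP => gy; first exact: gray_step_sound.
by apply: white_step_sound; rewrite /white gy.
Qed.

End Sound.

Lemma labels_sound n y : sound (labels n y) y.
Proof.
elim: n y => [|n IHn] y; last exact: step_sound.
rewrite /labels /= /init; case: ifPn => // /existsPn ny.
have {}ny z : ~ arc y z by apply/negP; exact: ny.
case: ifPn => gy; first by left; exact: dead_end_terminal.
by split=> //; apply: outcome_prev => // z /ny.
Qed.

Lemma labels_terminal n y : gray y -> (forall z, ~ arc y z) -> labels n y = New.
Proof.
move=> gy ny; elim: n => [|n IHn].
  rewrite /labels /= /init gy; case: ifPn => // /existsP[z /ny //].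
rewrite /labels iterS -/(labels n) /step gy /gray_step.
by case: pickP => // z /ny.
Qed.

Lemma gray_stepE (L : V -> label) y z : gray y -> arc y z ->
  step L y = if white z then
      match L z with
      | Full => New
      | Num k => NatSet (~` [set k])
      | Moon => NatSet setT
      | _ => L y
      end
    else
      match L z with
      | Full => New
      | New => Full
      | NatSet A => NatSet (~` A)
      | _ => L y
      end.
Proof.
move=> gy yz; rewrite /step gy /gray_step; case: pickP => [t yt|/(_ z)]; last by rewrite yz.
by rewrite (gray_arc_uniq gy yz yt).
Qed.

(** * Completeness of a stable labelling *)

Section Stable.
Variable L : V -> label.
Hypothesis sL : forall y, sound (L y) y.
Hypothesis L_stable : forall y, step L y = L y.
Hypothesis L_terminal : forall y, gray y -> (forall z, ~ arc y z) -> L y = New.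

Definition won_label b : label := if b then New else Full.

Lemma dead_end_label b y : dead_end b y -> L y = won_label b.
Proof.
elim=> {b y} [y gy ny|b y z gy yz d IH]; first exact: L_terminal.
rewrite -L_stable (gray_stepE _ gy yz) IH.
have [gz _] := dead_endE d; rewrite /white gz /=.
by case: (b).
Qed.

Lemma lead_full_label b y u : lead b y u -> L u = Full -> L y = won_label b.
Proof.
move=> le e; elim: le e => {b y u} [u wu //|b y z u gy yz le IH] e.
rewrite -L_stable (gray_stepE _ gy yz) IH //.
case: ifP => wz; last by case: (b).
by case: (leadE le) => [[_ -> _]|[t [/(white_gray wz)]]].
Qed.

Lemma lead_set_label b y u B : gray y -> lead b y u ->
  L u = Moon /\ B = set0 \/ (exists2 k, L u = Num k & B = [set k]) ->
  L y = NatSet (if b then ~` B else B).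
Proof.
move=> + le; elim: le => {b y u} [u wu /(white_gray wu) //|b y z u _ yz le IH] gy e.
rewrite -L_stable (gray_stepE _ gy yz); case: (white_or_gray z) => [wz|gz].
  rewrite wz; case: (leadE le) => [[_ -> eu]|[t [/(white_gray wz)]]] //.
  rewrite -eu; case: e => [[-> ->]|[k -> ->]] //=.
  by rewrite setC0.
by rewrite /white gz /= IH //; case: (b); rewrite /= ?setCK.
Qed.

Lemma Cr_gray k y : Cr L k y -> gray y.
Proof. by case. Qed.

Lemma Cr_gray_option k y z : gray y -> arc y z -> Cr_option L k z -> Cr L k y.
Proof. by move=> gy yz o; apply: Cr_node => // t yt; rewrite -(gray_arc_uniq gy yz yt). Qed.

(** Along a gray run [Cr] and [Cr_option] alternate, the former certifying a win of the previous
    player and the latter one of the next player. *)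
Lemma Cr_lead k b y u : lead b y u -> Cr_option L k u ->
  if b then Cr L k y else Cr_option L k y.
Proof.
elim=> {b y u} [//|b y z u gy yz _ IH] /IH; case: (b) => /= o.
  by apply: (Cr_gray_reply yz) => //; exact: Cr_gray o.
exact: Cr_gray_option yz o.
Qed.

Lemma Cr_lead_num k b y u : gray y -> lead b y u -> L u = Num k ->
  if b then Cr_option L k y else Cr L k y.
Proof.
move=> + le e; elim: le e => {b y u} [u wu _ /(white_gray wu) //|b y z u _ yz le IH] e gy.
case: (white_or_gray z) => [wz|gz].
  case: (leadE le) => [[_ -> eu]|[t [/(white_gray wz)]]] //=.
  by apply: (Cr_white_reply yz) => //; rewrite -eu.
have := IH e gz; case: (b) => /= o; first exact: Cr_gray_option yz o.
exact: Cr_gray_reply yz gz o.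
Qed.

Lemma Cr_option_reverts k y : Cr_option L k y -> L y = Unassigned -> reverts L k y.
Proof.
case=> {y} [y wy|y z yz wz e _|y z yz gz cr _]; last 2 first.
- by exists z => //; left.
- by exists z => //; right.
by case=> [->|->|[j ->]].
Qed.

Lemma full_label x : white x -> full x -> L x = Full.
Proof.
move=> + f.
have new y z : white y -> arc y z -> gray z -> L z = New -> L y = Full.
  move=> wy yz gz e; rewrite -L_stable /step (negbTE wy) /white_step.
  by case: asboolP => // -[]; exists z.
elim: f => {x} [x [y xy d]|x u [y xy le] _ IH] wx.
  by apply: new xy _ (dead_end_label d) => //; case: (dead_endE d).
apply: new xy _ (lead_full_label le (IH (lead_target le))) => //.
by case: (leadE le) => [[]|[t []]].
Qed.

Lemma Cr_option_num k b x u : move b x u -> white x ->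
  (if b then Cr_option L k u else L u = Num k) -> Cr_option L k x.
Proof.
case=> y xy le wx; case: b le => le e.
  have := Cr_lead le e => cr; exact: (Cr_gray_reply xy (Cr_gray cr)).
case: (white_or_gray y) => [wy|gy].
  case: (leadE le) => [[_ _ eu]|[t [/(white_gray wy)]]] //.
  by apply: (Cr_white_reply xy) => //; rewrite -eu.
exact: (Cr_gray_reply xy gy (Cr_lead_num gy le e)).
Qed.

Let option_set x := white_option_labels L x `|` gray_option_union L x.

Lemma option_set_num x u k : move false x u -> L u = Num k -> option_set x k.
Proof.
case=> y xy le e; case: (white_or_gray y) => [wy|gy].
  case: (leadE le) => [[_ _ eu]|[t [/(white_gray wy)]]] //.
  by left; exists y; split=> //; rewrite -eu.
right; exists y, [set k]; split=> //.
by rewrite (lead_set_label (B := [set k]) gy le) //; right; exists k.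
Qed.

Lemma lead_true_gray y u : lead true y u -> gray y.
Proof. by move=> /leadE[[]|[t []]]. Qed.

Lemma option_set_other x u j k :
  move true x u -> L u = Num j -> j <> k -> option_set x k.
Proof.
case=> y xy le e ne; have gy := lead_true_gray le.
right; exists y, (~` [set j]); split=> //; last by move=> /= e'; apply: ne.
by rewrite (lead_set_label (B := [set j]) gy le) //; right; exists j.
Qed.

Lemma white_step_num x m : white x -> out false m x -> is_mex (option_set x) m ->
  (forall y, arc x y -> L y = Unassigned -> reverts L m y) -> L x = Num m.
Proof.
move=> wx o me rev; rewrite -L_stable /step (negbTE wx) /white_step -/(option_set x).
case: asboolP => [[y [xy gy e]]|_].
  by case: (full_nnumeric (won_option xy _)); [have := sL y; rewrite e | exists m].
case: asboolP => [e|_]; first by case: me => -[]; rewrite e.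
by rewrite (mexE me); case: asboolP.
Qed.

(** No number is missed by the algorithm. For [c = true] the second part records how the win arises,
    which the mex rule needs in order to place each [j < m] in the option set. *)
Lemma out_label c m x : out c m x -> white x ->
  if c then Cr_option L m x /\
    [\/ wins x, exists2 u, move false x u & L u = Num m,
        exists u, move true x u | exists2 i, i < m & out false i x]
  else L x = Num m.
Proof.
elim=> {c m x} [m x w|m b x u mv o IH|m j x lt_jm o IH|m x nw ns om IHm oh IHh] wx.
- split; last exact: Or41.
  by apply: Cr_white => //; apply: Or32; apply: full_label => //; exact: full_wins.
- have wu : white u by case: mv => y _ /lead_target.
  have {}IH := IH wu; split.
    by apply: (Cr_option_num mv) => //; case: b {mv o} IH => // -[].
  by case: b mv o IH => mv o IH; [apply: Or43; exists u | apply: Or42; exists u].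
- split; last by apply: Or44; exists j.
  apply: Cr_white => //; apply: Or33; exists j; first exact: IH.
  by move=> e; rewrite e ltnn in lt_jm.
have o : out false m x by exact: out_prev.
have wt b u : move b x u -> white u by case=> y _ /lead_target.
apply: white_step_num => //; first split.
- move=> /(option_set_outcome sL)[y xy oy].
  by apply: (outcome_excl (outcome_prevE o xy)).
- move=> j lt_jm; case: (IHh j lt_jm wx) => _ [//|[u mv e]|[u mv]|[i lt_ij oi]].
  + exact: option_set_num mv e.
  (* Every threat from a position of number [m] leads to a node labelled [m], and the complement of
     [m] contributes [j]. *)
  + apply: (option_set_other mv (IHm _ _ mv (wt _ _ mv))) => e.
    by rewrite e ltnn in lt_jm.
  + have e := out_uniq oi o; rewrite e in lt_ij.
    by have := ltn_trans lt_ij lt_jm; rewrite ltnn.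
move=> y xy e; apply: Cr_option_reverts => //.
(* Dead ends are already labelled, so an unassigned option leads to a white node, where the
   induction hypothesis supplies the reply. *)
case: (outcome_prevE o xy) => [/dead_end_label|[b [u [le _]]]]; first by rewrite e.
have mv : move b x u by exists y.
have := IHm _ _ mv (wt _ _ mv); case: b le {mv} => /= le IH; last exact: (Cr_lead le IH.1).
by have := Cr_lead_num (lead_true_gray le) le IH.
Qed.

Lemma moonish_label x : moonish x -> white x -> L x = Moon \/ L x = Full.
Proof.
have moon y : white y -> option_set y = setT -> L y = Moon \/ L y = Full.
  move=> wy e; rewrite -L_stable /step (negbTE wy) /white_step -/(option_set y) e.
  by case: asboolP => _; [right | left; case: asboolP].
have wt (b : bool) y u : move b y u -> white u by case=> z _ /lead_target.
elim=> {x} [x base|x u mv _ IH] wx.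
  apply: moon => //; apply/seteqP; split=> k // _.
  case: (base k) => [[u mv o]|[u [j [mv o ne]]]].
    exact: option_set_num mv (out_label o (wt _ _ _ mv)).
  exact: option_set_other mv (out_label o (wt _ _ _ mv)) ne.
(* If [u] is [Full], so is [x]; if [u] is [Moon], the threat contributes the set of all numbers. *)
have wu := wt _ _ _ mv; case: (IH wu) => e; last first.
  right; apply: full_label => //; apply: (full_move mv).
  by apply: won_full => //; have := sL u; rewrite e.
apply: moon => //; apply/seteqP; split=> k // _.
case: mv => y xy le; have gy := lead_true_gray le.
right; exists y, setT; split=> //.
by rewrite (lead_set_label (B := set0) gy le) ?setC0 //; left.
Qed.

Lemma label_num x k : white x -> L x = Num k <-> out false k x.
Proof.
move=> wx; split=> [e|o]; last exact: (out_label o).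
by have := sL x; rewrite e => -[].
Qed.

Lemma label_full x : white x -> L x = Full <-> full x.
Proof.
move=> wx; split=> [e|]; last exact: full_label.
by apply: won_full => //; have := sL x; rewrite e.
Qed.

Lemma label_moon x : white x -> L x = Moon <-> moonish x /\ ~ full x.
Proof.
move=> wx; split=> [e|[mx nf]].
  split; first by have := sL x; rewrite e => -[].
  by move=> /(full_label wx); rewrite e.
by case: (moonish_label mx wx) => // /(label_full wx).
Qed.

Lemma label_unassigned x : white x ->
  L x = Unassigned <-> [/\ ~ full x, ~ moonish x & ~ numeric x].
Proof.
move=> wx; split=> [e|[nf nm nn]].
  split=> [/(full_label wx)|/moonish_label/(_ wx)[]|[k /(label_num _ wx)]]; by rewrite e.
have := sL x; case e: (L x) => [k|A||||] //= s.
- by case: nn; exists k; case: s.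
- by case: s => /(white_gray wx).
- by case: nf; exact: won_full.
- by case: nm; case: s.
- by case: (white_gray wx (won_true_gray s)).
Qed.

Lemma lead_forcing k y u : lead true y u -> (L u = Num k \/ forcing L k u) ->
  forall x, arc x y -> forcing L k x.
Proof.
move=> le h x xy.
(* [forcing] consumes two arcs at a time; a statement for both parities permits induction over
   single arcs. *)
suff : forall b, lead b y u -> if b then forall x, arc x y -> forcing L k x
    else y = u \/ forcing L k y by move=> /(_ _ le); apply.
move=> b {}le; elim: le h {x xy} => {b y u} [u wu|b y z u gy yz le IH] h; first by left.
move: (IH h); case: b {IH} le => /= le IH; first by right; exact: IH.
move=> x xy; case: IH => [ez|]; last exact: forcing_later xy gy yz.
subst z; case: h => [e|]; last exact: forcing_later xy gy yz.
exact: forcing_now xy gy yz (lead_target le) e.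
Qed.

Lemma forcing_forced x k : forcing L k x <-> exists2 u, move true x u & forced k u.
Proof.
split.
  elim=> {x} [x y z xy gy yz wz e|x y z xy gy yz _ [u [t zt le] f]].
    exists z; last by apply: forced_numeric; exact/label_num.
    by exists y => //; exact: lead_option.
  case: (white_or_gray z) => [wz|gz].
    exists z; first by exists y => //; exact: lead_option.
    by apply: forced_move f; exists t.
  exists u => //; exists y => //; rewrite -[true]negbK.
  by apply: (lead_gray gy yz); exact: lead_gray zt le.
move=> [u mv f]; elim: f x mv => {u} [u o|u v mv _ IH] x [y xy le];
  apply: (lead_forcing le) xy; [left | right; exact: IH].
exact/(label_num _ (lead_target le)).
Qed.

Lemma forcing_set x : white x -> ~ numeric x -> forcing_values L x = [set k | forced k x].
Proof.
move=> wx nn; apply/seteqP; split=> k /=.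
  by move=> /forcing_forced[u mv f]; exact: forced_move mv f.
move=> f; apply/forcing_forced; case: f nn => [y o|y u mv f] nn; last by exists u.
by case: nn; exists k.
Qed.

(** [direct] also passes a gray node by two arcs at once; the flag [b] keeps the parity, so that
    runs can be treated arc by arc. *)
Let dir k b y := if b then forall x, arc x y -> direct L k x else direct L k y.

Lemma dir_gray k b y z : gray y -> arc y z -> dir k b z -> dir k (~~ b) y.
Proof.
move=> gy yz; case: b => [|d x xy]; first exact.
by apply: (direct_gray xy gy) => t yt; rewrite -(gray_arc_uniq gy yz yt).
Qed.

Lemma lead_direct k b y u : lead b y u -> direct L k u -> dir k b y.
Proof. by elim=> {b y u} [//|b y z u gy yz _ IH] /IH; exact: dir_gray. Qed.

Lemma lead_num_direct k b y u : lead b y u -> L u = Num k -> dir k (~~ b) y.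
Proof.
elim=> {b y u} [u wu e x xu|b y z u gy yz _ IH /IH]; last exact: dir_gray.
exact: direct_white xu wu e.
Qed.

Lemma dead_end_direct k b y : dead_end b y -> dir k b y.
Proof.
elim=> {b y} [y gy ny x xy|b y z gy yz _]; last exact: dir_gray.
by apply: (direct_gray xy gy) => z /ny.
Qed.

Lemma direct_reached x k : direct L k x <-> reached k x.
Proof.
split; last first.
  elim=> {x} [x [y xy d]|x u [y xy le] o|x u [y xy le] _ IH].
  - exact: (dead_end_direct k d).
  - by apply: (lead_num_direct le) xy; exact/(label_num _ (lead_target le)).
  - exact: (lead_direct le IH).
elim=> {x} [x y xy wy e|x y xy gy _ IH].
  apply: (@reached_numeric _ _ _ y); first by exists y => //; exact: lead_white.
  exact/label_num.
case: (EM (exists z, arc y z)) => [[z yz]|ny]; last first.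
  apply: reached_wins; exists y => //; apply: dead_end_terminal => // z yz.
  by apply: ny; exists z.
have rz := IH z yz; case: (white_or_gray z) => [wz|gz].
  by apply: (reached_move _ rz); exists y => //; exact: lead_option.
(* Two more gray arcs restore the parity. *)
have back b u : move b z u -> move b x u.
  move=> [t zt le]; exists y => //; rewrite -[b]negbK.
  exact: (lead_gray gy yz (lead_gray gz zt le)).
case: rz back gz yz => {z} [z [t zt d]|z u mv o|z u mv r] back gz yz.
- apply: reached_wins; exists y => //.
  exact: (dead_end_gray gy yz (dead_end_gray gz zt d)).
- exact: reached_numeric (back _ _ mv) o.
- exact: reached_move (back _ _ mv) r.
Qed.

Lemma value_of_labelsP x g : white x -> value_of_labels L x g <-> has_value x g.
Proof.
move=> wx.
have dirE : direct_values L x = [set k | reached k x].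
  by apply/seteqP; split=> k /= /direct_reached.
split.
  case=> [n /label_num|/label_full|/label_moon|f /label_unassigned|/label_unassigned].
  - exact.
  - exact.
  - by move=> /(_ wx)[mx nf]; split=> //; rewrite forcing_set //; exact: moonish_nnumeric.
  - by move=> /(_ wx)[nf nm nn]; rewrite forcing_set.
  - move=> /(_ wx)[nf nm nn]; rewrite forcing_set // dirE => e.
    by split=> // k fk; have : [set k | forced k x] k by []; rewrite e.
case: g => [n o||F [nf mx <-]|f [nf nm nn e]|D [nf dx <-]].
- exact/value_num/label_num.
- by move=> f; exact/value_full/label_full.
- rewrite -forcing_set //; last exact: moonish_nnumeric.
  exact/value_moon/label_moon.
- by apply: value_nym; [exact/label_unassigned | rewrite forcing_set].
- have nn := drawish_nnumeric dx; rewrite -dirE; apply: value_inf.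
    by apply/label_unassigned => //; split=> // /moonish_forced[k /dx].
  by rewrite forcing_set //; apply/seteqP; split=> k //= /dx.
Qed.

End Stable.

(** * Termination of the algorithm *)

Lemma labelsS n y : labels n.+1 y = step (labels n) y.
Proof. by []. Qed.

Lemma eventually_option b y z N : gray y -> arc y z ->
  (forall n, N <= n -> labels n z = if b then New else Full) ->
  (gray z \/ b = false) ->
  forall n, N.+1 <= n -> labels n y = if ~~ b then New else Full.
Proof.
move=> gy yz H gz [//|n] le_Nn; rewrite labelsS (gray_stepE _ gy yz) H //.
case: ifP => wz; last by case: (b).
by case: gz => [/(white_gray wz) //|->].
Qed.

Lemma eventually_dead_end b y : dead_end b y ->
  exists N, forall n, N <= n -> labels n y = if b then New else Full.
Proof.
elim=> {b y} [y gy ny|b y z gy yz d [N IH]].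
  by exists 0 => n _; exact: labels_terminal.
exists N.+1; apply: (eventually_option gy yz IH); left.
by case: (dead_endE d).
Qed.

Lemma eventually_lead b y u N : lead b y u ->
  (forall n, N <= n -> labels n u = Full) ->
  exists N, forall n, N <= n -> labels n y = if b then New else Full.
Proof.
move=> le; elim: le N => {b y u} [u wu N H|b y z u gy yz le IH N /IH[M H]]; first by exists N.
exists M.+1; apply: (eventually_option gy yz H).
by case: (leadE le) => [[_ -> _]|[t [gz _ _]]]; [right | left].
Qed.

Lemma eventually_white x y N : white x -> arc x y -> gray y ->
  (forall n, N <= n -> labels n y = New) -> forall n, N.+1 <= n -> labels n x = Full.
Proof.
move=> wx xy gy H [//|n] le_Nn; rewrite labelsS /step (negbTE wx) /white_step.
by case: asboolP => // -[]; exists y; split=> //; exact: H.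
Qed.

Lemma eventually_full x : full x -> white x ->
  exists N, forall n, N <= n -> labels n x = Full.
Proof.
elim=> {x} [x [y xy d]|x u [y xy le] _ IH] wx.
  have [N H] := eventually_dead_end d; exists N.+1.
  by apply: (eventually_white wx xy _ H); case: (dead_endE d).
have [N H] := IH (lead_target le); have {N H} [N H] := eventually_lead le H.
exists N.+1; apply: (eventually_white wx xy _ H); exact: lead_true_gray le.
Qed.

Lemma step_assigned (L : V -> label) y : L y <> Unassigned -> step L y <> Unassigned.
Proof.
move=> ny; rewrite /step; case: ifP => gy.
  rewrite /gray_step; case: pickP => [z _|//].
  by case: ifP; case: (L z).
by rewrite /white_step; do 3?case: asboolP.
Qed.

Lemma labels_assigned m n y : m <= n -> labels m y <> Unassigned -> labels n y <> Unassigned.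
Proof.
move=> /subnKC <-; elim: (n - m) => [|d IHd] ny; first by rewrite addn0.
by rewrite addnS labelsS; apply: step_assigned; exact: IHd.
Qed.

(** Nodes satisfying [won] end up as [New] or [Full] for good, although [Moon] or a set may come
    first. Any other node keeps its first assigned label, as [sound_uniq] admits no second one. *)
Lemma eventually_constant y : exists N, forall n, N <= n -> labels n y = labels N y.
Proof.
case: (EM (exists b, won b y)) => [[b w]|nw].
  suff [N H] : exists N, forall n, N <= n -> labels n y = if b then New else Full.
    by exists N => n le_Nn; rewrite !H.
  case: w => [d|[u le f]]; first exact: eventually_dead_end.
  have [N H] := eventually_full f (lead_target le); exact: eventually_lead le H.
case: (EM (exists N, labels N y <> Unassigned)) => [[N a]|na].
  exists N => n le_Nn; apply: (@sound_uniq _ _ y) => //; try exact: labels_sound.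
    exact: labels_assigned le_Nn a.
  by move=> b w; apply: nw; exists b.
have un n : labels n y = Unassigned.
  by apply: contrapT => a; apply: na; exists n.
by exists 0 => n _; rewrite !un.
Qed.

Lemma exists_stable : exists n, stable V n.
Proof.
have [f H] := choice eventually_constant.
exists (\max_y f y) => y; have le_f := leq_bigmax (F := f) y.
by rewrite (H y _ (leqW le_f)) (H y _ le_f).
Qed.

Lemma exists_ends_at : exists t, ends_at V t.
Proof.
have ex : exists n, `[< stable V n >] by have [n s] := exists_stable; exists n; apply/asboolP.
case: (ex_minnP ex) => n /asboolP sn min_n; exists n.+1, n; split=> // k lt_kn /asboolP /min_n.
by rewrite leqNgt lt_kn.
Qed.

Lemma grundyP x g : white x -> grundy x g <-> has_value x g.
Proof.
move=> wx.
have H t : ends_at V t -> value_of_labels (labels t) x g <-> has_value x g.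
  move=> [n [-> sn _]].
  (* [ends_at] counts one step beyond the stable [n]; the labels are still those of step [n]. *)
  have -> : @labels V n.+1 = labels n by apply/funext.
  apply: (value_of_labelsP (labels_sound n) sn) => // y; exact: labels_terminal.
split=> [[_ [t /H]] [] //|v].
by split=> //; have [t et] := exists_ends_at; exists t => //; exact/H.
Qed.

End Chains.

(** * The cartproduct *)

(* The properties of a cartproduct [W] of [V] and [U], with its projections, put
   in a form that is symmetric in [V] and [U]. *)
Record is_cart (V U W : digraph) (l : W -> V) (r : W -> U) : Prop := IsCart {
  cart_inj p q : l p = l q -> r p = r q -> p = q;
  cart_whiteE p : white p <-> white (l p) /\ white (r p);
  cart_grayE p : gray p -> gray (l p) /\ white (r p) \/ gray (r p) /\ white (l p);
  cart_arcE p q : arc p q ->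
    [/\ arc (l p) (l q), r q = r p & white (r p)] \/
    [/\ arc (r p) (r q), l q = l p & white (l p)];
  cart_left p x : white (r p) -> arc (l p) x ->
    exists q, [/\ arc p q, l q = x & r q = r p];
  cart_right p y : white (l p) -> arc (r p) y ->
    exists q, [/\ arc p q, l q = l p & r q = y]
}.

Lemma is_cartC (V U W : digraph) (l : W -> V) (r : W -> U) :
  is_cart l r -> is_cart r l.
Proof.
case=> inj wE gE aE al ar; split=> [p q er el|p|p /gE[]|p q /aE[]|p y wl yr|p x wr xl].
- exact: inj.
- by split=> [/wE[]|[wr wl]] //; apply/wE.
- by right.
- by left.
- by right.
- by left.
- by have [q []] := ar _ _ wl yr; exists q.
- by have [q []] := al _ _ wr xl; exists q.
Qed.

Lemma cartproduct_is_cart (V U : digraph) :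
  is_cart (fun p : cartproduct V U => (val p).1) (fun p => (val p).2).
Proof.
split.
- move=> p q e1 e2; apply: val_inj; move: e1 e2.
  by case: (val p) (val q) => [a b] [a' b'] /= -> ->.
- move=> p; rewrite /white /= /cart_gray negb_or; split=> [/andP[]|[-> ->]] //.
- move=> p; have := valP p; rewrite /white /= /cart_gray.
  by case: (gray _); case: (gray _) => //= _ _; [left | right].
- move=> p q /orP[] /and3P[a /eqP e w]; [left | right]; by split.
- move=> p x wr a; have h : ~~ (gray (x, (val p).2).1 && gray (x, (val p).2).2).
    by rewrite /= (negbTE wr) andbF.
  exists (exist _ (x, (val p).2) h : cart_node V U); split=> //.
  by apply/orP; left; apply/and3P; split.
- move=> p y wl a; have h : ~~ (gray ((val p).1, y).1 && gray ((val p).1, y).2).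
    by rewrite /= (negbTE wl).
  exists (exist _ ((val p).1, y) h : cart_node V U); split=> //.
  by apply/orP; right; apply/and3P; split.
Qed.

Section Cart.
Variables (V U W : digraph) (l : W -> V) (r : W -> U).
Hypothesis C : is_cart l r.
Implicit Types (p q : W) (b : bool).

Lemma cart_gray_left p : gray (l p) -> gray p.
Proof.
by case: (white_or_gray p) => // /(cart_whiteE C)[wl _] /(white_gray wl).
Qed.

Lemma cart_gray_leftE p : gray p -> white (r p) -> gray (l p).
Proof. by case/(cart_grayE C) => [[]|[gr _] /white_gray/(_ gr)]. Qed.

Lemma cart_arc_leftE p q : gray (l p) -> arc p q -> arc (l p) (l q) /\ r q = r p.
Proof. by move=> gl /(cart_arcE C)[[]|[_ _ /white_gray/(_ gl)]]. Qed.

Lemma lead_left b p u : white (r p) -> lead b (l p) u ->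
  exists q, [/\ lead b p q, l q = u & r q = r p].
Proof.
move=> + le; move ex: (l p) le => x le; elim: le p ex => {b x u} [u wu|b x z u gx xz _ IH] p ex wr.
  by exists p; split=> //; apply: lead_white; apply/(cart_whiteE C); rewrite ex.
rewrite -ex in gx xz; have [t [pt lt rt]] := cart_left C wr xz.
have [|q [le lq rq]] := IH t lt; first by rewrite rt.
exists q; split; rewrite ?rq //.
exact: (lead_gray (cart_gray_left gx) pt le).
Qed.

Lemma lead_leftE b p q : lead b p q -> white (r p) -> lead b (l p) (l q) /\ r q = r p.
Proof.
elim=> {b p q} [q wq _|b p t q gp pt _ IH wr].
  by split=> //; apply: lead_white; case/(cart_whiteE C): wq.
have gl := cart_gray_leftE gp wr; have [lpt rt] := cart_arc_leftE gl pt.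
rewrite -rt in wr; have [le rq] := IH wr; rewrite -rt; split=> //.
exact: lead_gray gl lpt le.
Qed.

Lemma dead_end_left b p : white (r p) -> dead_end b (l p) <-> dead_end b p.
Proof.
move=> wr; split=> d.
  move ex: (l p) d => x d; elim: d p ex wr => {b x} [x gx nx|b x z gx xz _ IH] p ex wr.
    rewrite -ex in gx nx; apply: dead_end_terminal; first exact: cart_gray_left.
    by move=> q /(cart_arc_leftE gx)[/nx].
  rewrite -ex in gx xz; have [t [pt lt rt]] := cart_left C wr xz.
  by apply: (dead_end_gray (cart_gray_left gx) pt); apply: IH; rewrite ?rt.
elim: d wr => {b p} [p gp np|b p t gp pt _ IH] wr; have gl := cart_gray_leftE gp wr.
  by apply: dead_end_terminal => // x /(cart_left C wr)[q [/np]].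
have [lpt rt] := cart_arc_leftE gl pt.
by apply: (dead_end_gray gl lpt); apply: IH; rewrite rt.
Qed.

Lemma cart_move_left b p u : white (r p) -> move b (l p) u ->
  exists q, [/\ move b p q, l q = u & r q = r p].
Proof.
move=> wr [y ly le]; have [t [pt lt rt]] := cart_left C wr ly.
rewrite -lt in le; have [|q [leq lq rq]] := @lead_left b t u _ le; first by rewrite rt.
by exists q; split; rewrite ?rq //; exists t.
Qed.

Lemma cart_wins_left p : white (r p) -> wins (l p) -> wins p.
Proof.
move=> wr [y ly d]; have [t [pt lt rt]] := cart_left C wr ly.
by exists t => //; apply/dead_end_left; rewrite ?lt ?rt.
Qed.

Lemma cart_stalls_left p : white (r p) -> stalls (l p) -> stalls p.
Proof.
move=> wr [y [ly nl nd]]; have [t [pt lt rt]] := cart_left C wr ly.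
have wt : white (r t) by rewrite rt.
exists t; split=> // [b q|b].
  by move=> /lead_leftE/(_ wt)[+ _]; rewrite lt => /nl.
by move=> /(dead_end_left _ wt); rewrite lt => /nd.
Qed.

Lemma cart_outdegree_left p q q' : gray_outdegree_le1 V ->
  gray (l p) -> arc p q -> arc p q' -> q = q'.
Proof.
move=> hV gl /(cart_arc_leftE gl)[lq rq] /(cart_arc_leftE gl)[lq' rq'].
apply: (cart_inj C); first exact: (gray_arc_uniq hV gl lq lq').
by rewrite rq.
Qed.

End Cart.

Lemma cart_outdegree (V U W : digraph) (l : W -> V) (r : W -> U) : is_cart l r ->
  gray_outdegree_le1 V -> gray_outdegree_le1 U -> gray_outdegree_le1 W.
Proof.
move=> C hV hU p gp; apply/card_le1_eqP => q q' pq pq'.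
case/(cart_grayE C): gp => [[gl _]|[gr _]].
  exact: (cart_outdegree_left C hV gl pq' pq).
exact: (cart_outdegree_left (is_cartC C) hU gr pq' pq).
Qed.

(** While a gray run is followed in one component, the other is white and stays fixed, so the runs
    of the product are runs of a single component. *)
Lemma cart_is_sum (V U W : digraph) (l : W -> V) (r : W -> U) : is_cart l r ->
  is_sum (l : contracted W -> contracted V) (r : contracted W -> contracted U)
    (fun p => white p).
Proof.
move=> C; have C' := is_cartC C; split.
- move=> b p q wp [t pt le]; split; first exact: lead_target le.
  case/(cart_arcE C): pt => [[a e w]|[a e w]]; [left | right].
    rewrite -e in w; have [le' ->] := lead_leftE C le w.
    by split=> //; exists (l t).
  rewrite -e in w; have [le' ->] := lead_leftE C' le w.
  by split=> //; exists (r t).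
- by move=> b p u /(cart_whiteE C)[wl wr]; exact: cart_move_left.
- move=> b p u /(cart_whiteE C)[wl wr] /(cart_move_left C' wl)[q [*]].
  by exists q; split.
- move=> p /(cart_whiteE C)[wl wr]; split=> [[t pt d]|[]]; last 2 first.
  + exact: (cart_wins_left C).
  + exact: (cart_wins_left C').
  case/(cart_arcE C): pt => [[a e w]|[a e w]]; rewrite -e in w; [left | right].
    by exists (l t) => //; apply/(dead_end_left C).
  by exists (r t) => //; apply/(dead_end_left C').
- move=> p /(cart_whiteE C)[wl wr]; split=> [[t [pt nl nd]]|[]]; last 2 first.
  + exact: (cart_stalls_left C).
  + exact: (cart_stalls_left C').
  case/(cart_arcE C): pt => [[a e w]|[a e w]]; rewrite -e in w; [left | right].
    exists (l t); split=> // [b u /(lead_left C w)[q [/nl]]|b] //.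
    by move=> /(dead_end_left C _ w)/nd.
  exists (r t); split=> // [b u /(lead_left C' w)[q [/nl]]|b] //.
  by move=> /(dead_end_left C' _ w)/nd.
Qed.

Theorem theorem2p5 (V U : digraph)
    (hV : gray_outdegree_le1 V) (hU : gray_outdegree_le1 U)
    (x : V) (y : U) (hx : white x) (hy : white y) (g h : gvalue) :
  grundy x g -> grundy y h -> grundy (sum_node hx hy) (gsum g h).
Proof.
have C := cartproduct_is_cart V U.
have wz : white (sum_node hx hy) by apply/(cart_whiteE C).
move=> /(grundyP hV _ hx) vx /(grundyP hU _ hy) vy.
apply/(grundyP (cart_outdegree C hV hU) _ wz).
exact: (value_sum (cart_is_sum C) wz vx vy).
Qed.
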